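(* Let $\mathcal C$ be a modular fusion category (over $\mathbb C$) such that $K(\mathcal C)$ is Burnside and the group $G(\mathcal C)$ of (isomorphism classes of) invertible objects has odd order. Then in $K(\mathcal C)\otimes_{\mathbb Z}\mathbb C$: $$\prod_{i=1}^m\frac{x_i}{d_i}=\frac{1}{\dim(\mathcal C_{ad})}\Big(\sum_{x_i\in\mathrm{Irr}(\mathcal C_{ad})}d_i\,x_i\Big).$$
   Context: $X_1,\dots,X_m$ are representatives of the isomorphism classes of simple objects of $\mathcal C$ ($X_1$ the unit), $x_i=[X_i]\in K(\mathcal C)$ (the Grothendieck ring), $d_i=\mathrm{FPdim}(X_i)$ the Frobenius–Perron dimension. $\mathcal C_{ad}$ is the adjoint fusion subcategory, generated by all $X_i\otimes X_i^*$; $x_i\in\mathrm{Irr}(\mathcal C_{ad})$ means $X_i\in\mathcal C_{ad}$; $\dim(\mathcal C_{ad})$ is the (global) categorical dimension of $\mathcal C_{ad}$. $K(\mathcal C)$ is Burnside if for every $i$: there is a unital ring morphism $\mu:K(\mathcal C)\to\mathbb C$ with $\mu(x_i)=0$ if and only if $x_i$ is not grouplike, where $x_i$ is grouplike if $x_i\,[X_i^*]=1$ (equivalently, $X_i$ is invertible). *)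

(* Defs.v *)
From mathcomp Require Import all_boot all_order all_algebra.
From mathcomp Require Import boolp classical_sets reals.
From mathcomp Require Import complex.

Set Implicit Arguments.
Unset Strict Implicit.
Unset Printing Implicit Defensive.

Import GRing.Theory.
Local Open Scope ring_scope.

Declare Scope cat_scope.
Delimit Scope cat_scope with cat.
Local Open Scope cat_scope.

Reserved Notation "g \oc f" (at level 41, right associativity).
Reserved Notation "X \ot Y" (at level 39, left associativity).
Reserved Notation "f \om g" (at level 39, left associativity).

(* K-linear categories with finite-dimensional spaces of morphisms.  Equality
   of morphisms is Leibniz equality; objects are compared up to isomorphism. *)
Record linCat (K : fieldType) := LinCat {
  Ob :> Type;
  Hom : Ob -> Ob -> vectType K;
  idm : forall X, Hom X X;
  comp : forall X Y Z, Hom Y Z -> Hom X Y -> Hom X Z;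
  comp_linl : forall X Y Z (a : K) (g g' : Hom Y Z) (f : Hom X Y),
    comp (a *: g + g') f = a *: comp g f + comp g' f;
  comp_linr : forall X Y Z (a : K) (g : Hom Y Z) (f f' : Hom X Y),
    comp g (a *: f + f') = a *: comp g f + comp g f';
  compA : forall W X Y Z (h : Hom Y Z) (g : Hom X Y) (f : Hom W X),
    comp h (comp g f) = comp (comp h g) f;
  comp1m : forall X Y (f : Hom X Y), comp (idm Y) f = f;
  compm1 : forall X Y (f : Hom X Y), comp f (idm X) = f
}.
Arguments Hom {K l} X Y.
Arguments idm {K l} X.
Arguments comp {K l X Y Z} g f.
Notation "g \oc f" := (comp g f) : cat_scope.

Section LinearCategories.
Context {K : fieldType} {C : linCat K}.
Implicit Types X Y Z W : C.

Definition mutually_inverse X Y (f : Hom X Y) (g : Hom Y X) : Prop :=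
  g \oc f = idm X /\ f \oc g = idm Y.

Definition is_iso X Y (f : Hom X Y) : Prop := exists g, mutually_inverse f g.

Definition isomorphic X Y : Prop := exists f : Hom X Y, is_iso f.

Definition zero_object Z : Prop :=
  forall X, (forall f : Hom Z X, f = 0) /\ (forall f : Hom X Z, f = 0).

(* For n = 0 this says that Z is a zero object. *)
Definition direct_sum n (F : 'I_n -> C) Z : Prop :=
  exists (inj : forall k, Hom (F k) Z) (prj : forall k, Hom Z (F k)),
    [/\ forall k, prj k \oc inj k = idm (F k),
        forall k l, k != l -> prj k \oc inj l = 0
      & \sum_k inj k \oc prj k = idm Z].

Definition mono X Y (f : Hom X Y) : Prop :=
  forall W (g h : Hom W X), f \oc g = f \oc h -> g = h.

Definition epi X Y (f : Hom X Y) : Prop :=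
  forall W (g h : Hom Y W), g \oc f = h \oc f -> g = h.

Definition is_kernel X Y (f : Hom X Y) Z (k : Hom Z X) : Prop :=
  f \oc k = 0 /\
  forall W (g : Hom W X), f \oc g = 0 -> exists! h : Hom W Z, k \oc h = g.

Definition is_cokernel X Y (f : Hom X Y) Z (q : Hom Y Z) : Prop :=
  q \oc f = 0 /\
  forall W (g : Hom Y W), g \oc f = 0 -> exists! h : Hom Z W, h \oc q = g.

Definition simple X : Prop :=
  ~ zero_object X /\
  forall Y (f : Hom Y X), mono f -> zero_object Y \/ is_iso f.

Definition iso_class_reps (P : C -> Prop) n (X : 'I_n -> C) : Prop :=
  [/\ forall i, P (X i),
      forall i j, isomorphic (X i) (X j) -> i = j
    & forall Y, P Y -> exists i, isomorphic Y (X i)].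

End LinearCategories.

Section AbelianSemisimple.
Context {K : fieldType} (C : linCat K).

Definition abelian_cat : Prop :=
  [/\ forall n (F : 'I_n -> C), exists Z, direct_sum F Z,
      forall (X Y : C) (f : Hom X Y), exists Z (k : Hom Z X), is_kernel f k,
      forall (X Y : C) (f : Hom X Y), exists Z (q : Hom Y Z), is_cokernel f q,
      forall (X Y : C) (k : Hom X Y), mono k ->
        exists Z (f : Hom Y Z), is_kernel f k
    & forall (X Y : C) (q : Hom X Y), epi q ->
        exists Z (f : Hom Z X), is_cokernel f q].

Definition semisimple_cat : Prop :=
  forall Z : C, exists n (F : 'I_n -> C),
    (forall k, simple (F k)) /\ direct_sum F Z.

Definition finitely_many_simples : Prop :=
  exists n (X : 'I_n -> C), iso_class_reps simple X.

End AbelianSemisimple.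

(* Monoidal K-linear categories; neither associativity nor unitality is assumed
   to be strict.  [assoc'], [lunit'], [runit'] are the inverses of [assoc],
   [lunit], [runit]. *)
Record monCat (K : fieldType) := MonCat {
  mon_lin :> linCat K;
  tens : mon_lin -> mon_lin -> mon_lin;
  tensm : forall X X' Y Y' : mon_lin,
    Hom X X' -> Hom Y Y' -> Hom (tens X Y) (tens X' Y');
  unit_ob : mon_lin;
  assoc : forall X Y Z, Hom (tens (tens X Y) Z) (tens X (tens Y Z));
  assoc' : forall X Y Z, Hom (tens X (tens Y Z)) (tens (tens X Y) Z);
  lunit : forall X, Hom (tens unit_ob X) X;
  lunit' : forall X, Hom X (tens unit_ob X);
  runit : forall X, Hom (tens X unit_ob) X;
  runit' : forall X, Hom X (tens X unit_ob);
  tensm_linl : forall X X' Y Y' (a : K) (f f' : Hom X X') (g : Hom Y Y'),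
    tensm (a *: f + f') g = a *: tensm f g + tensm f' g;
  tensm_linr : forall X X' Y Y' (a : K) (f : Hom X X') (g g' : Hom Y Y'),
    tensm f (a *: g + g') = a *: tensm f g + tensm f g';
  tensm_id : forall X Y, tensm (idm X) (idm Y) = idm (tens X Y);
  tensm_comp : forall X X' X'' Y Y' Y'' (f' : Hom X' X'') (f : Hom X X')
      (g' : Hom Y' Y'') (g : Hom Y Y'),
    tensm (f' \oc f) (g' \oc g) = tensm f' g' \oc tensm f g;
  assocK : forall X Y Z, mutually_inverse (assoc X Y Z) (assoc' X Y Z);
  lunitK : forall X, mutually_inverse (lunit X) (lunit' X);
  runitK : forall X, mutually_inverse (runit X) (runit' X);
  assoc_nat : forall X X' Y Y' Z Z'
      (f : Hom X X') (g : Hom Y Y') (h : Hom Z Z'),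
    assoc X' Y' Z' \oc tensm (tensm f g) h
      = tensm f (tensm g h) \oc assoc X Y Z;
  lunit_nat : forall X Y (f : Hom X Y),
    lunit Y \oc tensm (idm unit_ob) f = f \oc lunit X;
  runit_nat : forall X Y (f : Hom X Y),
    runit Y \oc tensm f (idm unit_ob) = f \oc runit X;
  pentagon : forall W X Y Z,
    assoc W X (tens Y Z) \oc assoc (tens W X) Y Z
      = tensm (idm W) (assoc X Y Z) \oc assoc W (tens X Y) Z
          \oc tensm (assoc W X Y) (idm Z);
  triangle : forall X Y,
    tensm (idm X) (lunit Y) \oc assoc X unit_ob Y = tensm (runit X) (idm Y)
}.
Arguments tens {K m} X Y.
Arguments tensm {K m X X' Y Y'} f g.
Arguments unit_ob {K m}.
Arguments assoc {K m} X Y Z.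
Arguments assoc' {K m} X Y Z.
Arguments lunit {K m} X.
Arguments lunit' {K m} X.
Arguments runit {K m} X.
Arguments runit' {K m} X.
Notation "X \ot Y" := (tens X Y) : cat_scope.
Notation "f \om g" := (tensm f g) : cat_scope.

Section Duality.
Context {K : fieldType} {C : monCat K}.
Implicit Types X D : C.

(* D is a left dual of X, equivalently X is a right dual of D. *)
Definition is_left_dual X D
    (e : Hom (D \ot X) unit_ob) (c : Hom unit_ob (X \ot D)) : Prop :=
  runit X \oc (idm X \om e) \oc assoc X D X \oc (c \om idm X) \oc lunit' X
    = idm X /\
  lunit D \oc (e \om idm D) \oc assoc' D X D \oc (idm D \om c) \oc runit' D
    = idm D.

Definition invertible X : Prop :=
  exists Y, isomorphic (X \ot Y) unit_ob /\ isomorphic (Y \ot X) unit_ob.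

End Duality.

Record fusionCat (K : fieldType) := FusionCat {
  fus_mon :> monCat K;
  fus_abelian : abelian_cat fus_mon;
  fus_semisimple : semisimple_cat fus_mon;
  fus_finite : finitely_many_simples fus_mon;
  fus_unit_simple : simple (@unit_ob K fus_mon);
  dual : fus_mon -> fus_mon;
  ev : forall X, Hom (dual X \ot X) unit_ob;
  coev : forall X, Hom unit_ob (X \ot dual X);
  dualP : forall X, is_left_dual (ev X) (coev X);
  right_dual_ex : forall X : fus_mon,
    exists Y (e : Hom (X \ot Y) unit_ob) (c : Hom unit_ob (Y \ot X)),
      is_left_dual e c
}.
Arguments dual {K f} X.
Arguments ev {K f} X.
Arguments coev {K f} X.

Section FusionCategories.
Context {K : fieldType} {C : fusionCat K}.

(* The transpose f^* : Y^* -> X^* of f : X -> Y. *)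
Definition dual_mor (X Y : C) (f : Hom X Y) : Hom (dual Y) (dual X) :=
  lunit (dual X) \oc (ev Y \om idm (dual X)) \oc assoc' (dual Y) Y (dual X)
    \oc (idm (dual Y) \om (f \om idm (dual X)))
    \oc (idm (dual Y) \om coev X) \oc runit' (dual Y).

(* Full subcategories are given by their objects; closure under isomorphism is
   the case n = 1 of closure under direct sums. *)
Record fusion_subcategory (P : C -> Prop) : Prop := FusionSubcategory {
  fsub_sum : forall n (F : 'I_n -> C) Z,
    (forall k, P (F k)) -> direct_sum F Z -> P Z;
  fsub_summand : forall n (F : 'I_n -> C) Z,
    P Z -> direct_sum F Z -> forall k, P (F k);
  fsub_unit : P unit_ob;
  fsub_tens : forall X Y, P X -> P Y -> P (X \ot Y);
  fsub_dual : forall X, P X -> P (dual X)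
}.

Definition in_adjoint (Y : C) : Prop :=
  forall P : C -> Prop, fusion_subcategory P ->
    (forall S : C, simple S -> P (S \ot dual S)) -> P Y.

End FusionCategories.

(* Premodular = braided fusion category with a ribbon structure. *)
Record premodularCat (K : fieldType) := PremodularCat {
  premod_fus :> fusionCat K;
  braid : forall X Y : premod_fus, Hom (X \ot Y) (Y \ot X);
  twist : forall X : premod_fus, Hom X X;
  braid_iso : forall X Y, is_iso (braid X Y);
  braid_nat : forall (X X' Y Y' : premod_fus) (f : Hom X X') (g : Hom Y Y'),
    braid X' Y' \oc (f \om g) = (g \om f) \oc braid X Y;
  hexagon1 : forall X Y Z,
    assoc Y Z X \oc braid X (Y \ot Z) \oc assoc X Y Z
      = (idm Y \om braid X Z) \oc assoc Y X Z \oc (braid X Y \om idm Z);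
  hexagon2 : forall X Y Z,
    assoc' Z X Y \oc braid (X \ot Y) Z \oc assoc' X Y Z
      = (braid X Z \om idm Y) \oc assoc' X Z Y \oc (idm X \om braid Y Z);
  twist_iso : forall X, is_iso (twist X);
  twist_nat : forall (X Y : premod_fus) (f : Hom X Y),
    twist Y \oc f = f \oc twist X;
  twist_tens : forall X Y,
    twist (X \ot Y) = (twist X \om twist Y) \oc braid Y X \oc braid X Y;
  twist_dual : forall X, twist (dual X) = dual_mor (twist X)
}.
Arguments braid {K p} X Y.
Arguments twist {K p} X.

Section Traces.
Context {K : fieldType} {C : premodularCat K}.

(* The coefficient of id in an endomorphism of the unit; End(1) is the line
   spanned by id when K is algebraically closed. *)
Definition unit_scalar (f : @Hom K C unit_ob unit_ob) : K :=
  coord [tuple @idm K C unit_ob] ord0 f.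

(* The quantum trace with respect to the pivotal structure u \o twist, where u
   is the Drinfeld morphism X -> X^**, which satisfies
   ev_{X^*} (u_X (x) id) = ev_X c_{X,X^*}. *)
Definition qtrace (X : C) (f : Hom X X) : K :=
  unit_scalar
    (ev X \oc braid X (dual X) \oc ((twist X \oc f) \om idm (dual X))
       \oc coev X).

Definition qdim (X : C) : K := qtrace (idm X).

Definition Smatrix n (X : 'I_n -> C) : 'M[K]_n :=
  \matrix_(i, j) qtrace (braid (X j) (X i) \oc braid (X i) (X j)).

(* The squared norm of a simple object S is qdim S * qdim S^*. *)
Definition adjoint_dim n (X : 'I_n -> C) : K :=
  \sum_(i | `[< in_adjoint (X i) >]) qdim (X i) * qdim (dual (X i)).

End Traces.

Record modularCat (K : fieldType) := ModularCat {
  mod_premod :> premodularCat K;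
  S_nondegenerate : forall n (X : 'I_n -> mod_premod),
    iso_class_reps simple X -> Smatrix X \in unitmx
}.

(* The Grothendieck ring with coefficients in A, for representatives X of the
   simple objects: row vectors of coordinates in the basis of the classes of
   the X_i.  K(C) is the case A = int, and K(C) (x) F the case A = F. *)
Section GrothendieckRing.
Context {K : fieldType} {C : fusionCat K} {m : nat} (X : 'I_m -> C).

(* By semisimplicity, the multiplicity of X_k in Y is dim Hom(X_k, Y). *)
Definition multiplicity (k : 'I_m) (Y : C) : nat := \dim {: Hom (X k) Y}.

Definition Kclass (A : pzRingType) (Y : C) : 'rV[A]_m :=
  \row_k (multiplicity k Y)%:R.

Definition Kmul (A : pzRingType) (u v : 'rV[A]_m) : 'rV[A]_m :=
  \sum_i \sum_j (u 0 i * v 0 j) *: Kclass A (X i \ot X j).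

Definition Kone (A : pzRingType) : 'rV[A]_m := Kclass A unit_ob.

Definition Kring_morphism (B : pzRingType) (mu : 'rV[int]_m -> B) : Prop :=
  [/\ mu (Kone int) = 1,
      forall u v, mu (u + v) = mu u + mu v
    & forall u v, mu (Kmul u v) = mu u * mu v].

Definition grouplike (i : 'I_m) : Prop :=
  Kmul (Kclass int (X i)) (Kclass int (dual (X i))) = Kone int.

(* Row j: the coordinates of [Y][X_j]. *)
Definition left_mul_mx (A : pzRingType) (Y : C) : 'M[A]_m :=
  \matrix_(j, k) Kmul (Kclass A Y) (Kclass A (X j)) 0 k.

(* The largest nonnegative eigenvalue of multiplication by [Y]; the set is
   finite, and nonempty by the Frobenius-Perron theorem. *)
Definition FPdim (R : realType) (Y : C) : R :=
  sup [set r : R | 0 <= r /\ eigenvalue (left_mul_mx R Y) r]%classic.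

End GrothendieckRing.

Definition burnside (R : realType) (C : fusionCat R[i]) m (X : 'I_m -> C) :
    Prop :=
  forall i : 'I_m,
    (exists mu : 'rV[int]_m -> R[i],
       Kring_morphism X mu /\ mu (Kclass X int (X i)) = 0)
    <-> ~ grouplike X i.

(* Main.v *)
(* For X_i simple, encircling X_i by a loop coloured by X gives a scalar chi_i(X);
   chi_i is a character of the Grothendieck ring and S_ij = qdim X_i * chi_i(X_j),
   so the chi_i are all the characters, they separate points, and symmetry of S
   makes chi_i(X_j) = 0 equivalent to chi_j(X_i) = 0.  The Frobenius-Perron
   dimension d is one of them, chi_j0.

   It suffices to compare the two sides under each chi_j.  If X_j is not
   invertible, the Burnside property and the symmetry of S give an i with
   chi_j(X_i) = 0, so the left side vanishes; the right side vanishes because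
   otherwise chi_j = d on C_ad, whence |chi_j(X_i)|^2 = chi_j([X_i][dual X_i]) = d_i^2
   is nonzero for all i.  The same argument shows that X_j0 is invertible.  If X_j
   is invertible, |chi_j(X_i)| = |qdim X_i| = d_i for all i; the equality case of
   the triangle inequality gives chi_j = d on C_ad, and the right side is 1.  On
   the left, the factors chi_j(X_i) / d_i are roots of unity of odd order by
   symmetry of S and Lagrange's theorem in G(C), while invariance under duality
   makes their product real, hence equal to 1. *)
From HB Require Import structures.
Require Import Defs.
From mathcomp Require Import classical_sets.
From mathcomp Require Import all_boot all_order all_algebra.
From mathcomp Require Import boolp reals complex ring.
Import Defs VectorInternalTheory.

Set Implicit Arguments.
Unset Strict Implicit.
Unset Printing Implicit Defensive.

Import Order.TTheory GRing.Theory Num.Theory.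
Local Open Scope ring_scope.
Local Open Scope cat_scope.

(** * Linear categories *)

Section LinearCategories.
Context {K : fieldType} {C : linCat K}.
Implicit Types X Y Z W : C.

Lemma compDl X Y Z (g g' : Hom Y Z) (f : Hom X Y) :
  (g + g') \oc f = g \oc f + g' \oc f.
Proof. by rewrite -[g]scale1r comp_linl !scale1r. Qed.

Lemma compDr X Y Z (g : Hom Y Z) (f f' : Hom X Y) :
  g \oc (f + f') = g \oc f + g \oc f'.
Proof. by rewrite -[f]scale1r comp_linr !scale1r. Qed.

Lemma comp0m X Y Z (f : Hom X Y) : (0 : Hom Y Z) \oc f = 0.
Proof. by apply: (addrI ((0 : Hom Y Z) \oc f)); rewrite -compDl !addr0. Qed.

Lemma compm0 X Y Z (g : Hom Y Z) : g \oc (0 : Hom X Y) = 0.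
Proof. by apply: (addrI (g \oc (0 : Hom X Y))); rewrite -compDr !addr0. Qed.

Lemma compZl X Y Z a (g : Hom Y Z) (f : Hom X Y) :
  (a *: g) \oc f = a *: (g \oc f).
Proof. by rewrite -[a *: g]addr0 comp_linl comp0m addr0. Qed.

Lemma compZr X Y Z a (g : Hom Y Z) (f : Hom X Y) :
  g \oc (a *: f) = a *: (g \oc f).
Proof. by rewrite -[a *: f]addr0 comp_linr compm0 addr0. Qed.

Lemma compNr X Y Z (g : Hom Y Z) (f : Hom X Y) : g \oc (- f) = - (g \oc f).
Proof. by rewrite -scaleN1r compZr scaleN1r. Qed.

Lemma compNl X Y Z (g : Hom Y Z) (f : Hom X Y) : (- g) \oc f = - (g \oc f).
Proof. by rewrite -scaleN1r compZl scaleN1r. Qed.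

Lemma comp_sumr X Y Z I (r : seq I) (P : pred I) (g : Hom Y Z)
    (F : I -> Hom X Y) :
  g \oc (\sum_(i <- r | P i) F i) = \sum_(i <- r | P i) g \oc F i.
Proof. by apply: (big_morph _ (compDr g) (compm0 X g)). Qed.

Lemma comp_suml X Y Z I (r : seq I) (P : pred I) (F : I -> Hom Y Z)
    (f : Hom X Y) :
  (\sum_(i <- r | P i) F i) \oc f = \sum_(i <- r | P i) F i \oc f.
Proof.
by apply: (big_morph (fun g : Hom Y Z => g \oc f)) => [g g'|];
  rewrite ?compDl ?comp0m.
Qed.

(** Composites are kept associated to the right; this form lets an equation between short composites
    rewrite at the head of a longer one. *)
Lemma compR X Y Z W (u : Hom Y Z) (v : Hom X Y) w (e : u \oc v = w)
  (r : Hom W X) : u \oc v \oc r = w \oc r.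
Proof. by rewrite compA e. Qed.

Lemma compRR X Y Y' Z W (u : Hom Y Z) (v : Hom X Y) (w1 : Hom Y' Z) w2
  (e : u \oc v = w1 \oc w2) (r : Hom W X) : u \oc v \oc r = w1 \oc w2 \oc r.
Proof. by rewrite !compA e. Qed.

Lemma isomorphic_refl X : isomorphic X X.
Proof. by exists (idm X), (idm X); split; rewrite comp1m. Qed.

Lemma isomorphic_sym X Y : isomorphic X Y -> isomorphic Y X.
Proof. by case=> f [g [h1 h2]]; exists g, f. Qed.

Lemma isomorphic_trans X Y Z :
  isomorphic X Y -> isomorphic Y Z -> isomorphic X Z.
Proof.
case=> f [f' [f1 f2]] [g [g' [g1 g2]]]; exists (g \oc f), (f' \oc g'); split.
  by rewrite -!compA (compR g1) comp1m.
by rewrite -!compA (compR f2) comp1m.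
Qed.

Lemma zero_objectP X : zero_object X <-> idm X = 0.
Proof.
split=> [z|e Y]; first by case: (z X).
by split=> f; [rewrite -[f]compm1 e compm0 | rewrite -[f]comp1m e comp0m].
Qed.

Lemma isomorphic_direct_sum X Y :
  isomorphic X Y -> direct_sum (fun _ : 'I_1 => X) Y.
Proof.
move=> [f [g [gf fg]]]; exists (fun=> f), (fun=> g); split=> //.
- by move=> k l; rewrite (ord1 k) (ord1 l).
- by rewrite big_ord1.
Qed.

Lemma direct_sum_iso_l n (F : 'I_n -> C) Y Z :
  direct_sum F Y -> isomorphic Y Z -> direct_sum F Z.
Proof.
case=> i [p [h1 h2 h3]] [f [g [gf fg]]].
exists (fun k => f \oc i k), (fun k => p k \oc g); split.
- by move=> k; rewrite -compA (compR gf) comp1m.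
- by move=> k l kl; rewrite -compA (compR gf) comp1m h2.
- under eq_bigr do rewrite -compA (compA (i _)).
  by rewrite -comp_sumr -comp_suml h3 comp1m.
Qed.

Lemma direct_sum1_iso (F : 'I_1 -> C) Z : direct_sum F Z -> isomorphic (F ord0) Z.
Proof.
case=> i [p [h1 _ h3]]; exists (i ord0), (p ord0).
by split; rewrite ?h1// -h3 big_ord1.
Qed.

End LinearCategories.

(** A left inverse forces the kernel of the associated linear function to be zero, so its image has
    the dimension of its source. *)
Lemma dim_bij_le (K : fieldType) (U V : vectType K) (f : U -> V) (g : V -> U) :
  (forall a u v, f (a *: u + v) = a *: f u + f v) -> cancel f g ->
  (\dim {: U} <= \dim {: V})%N.
Proof.
move=> lf fK.
pose flin := GRing.isLinear.Build K U V *:%R f lf.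
pose F : {linear U -> V} := HB.pack f flin.
have k0 : lker (linfun F) == 0%VS.
  apply/lker0P => u v; rewrite !lfunE /= => e.
  by rewrite -(fK u) -(fK v) e.
rewrite -(limg_dim_eq (f := linfun F) (U := {:U})) ?dimvS ?subvf//.
by rewrite (eqP k0) capv0.
Qed.

(** * Schur's lemma and Hom spaces of semisimple objects *)

Section Schur.
Context {K : numClosedFieldType} {C : linCat K}.
Hypothesis C_abelian : abelian_cat C.
Implicit Types X Y Z W S : C.

Lemma simple_idm_neq0 S : simple S -> idm S != 0.
Proof. by case=> nz _; apply/eqP => /zero_objectP. Qed.

(** The kernel of [f] is a subobject of the simple [S]. It cannot be all of [S] since [f] is
    nonzero, so it is zero and [f] is a monomorphism into the simple [S']. *)
Lemma simple_hom_iso S S' (f : Hom S S') :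
  simple S -> simple S' -> f != 0 -> is_iso f.
Proof.
move=> [nz sS] [_ sS'] f0; case: C_abelian => _ ker _ _ _.
have [Z [k [fk0 uk]]] := ker _ _ f.
have kmono : mono k.
  move=> W g h e.
  have /(uk _) [x [_ u2]] : f \oc k \oc g = 0 by rewrite compA fk0 comp0m.
  by rewrite -(u2 g erefl) (u2 h) ?e.
have fmono : mono f.
  case: (sS _ _ kmono) => [zZ|[k' [_ kk']]]; last first.
    by case/eqP: f0; rewrite -[f]compm1 -kk' compA fk0 comp0m.
  move=> W g h e.
  have fd : f \oc (g - h) = 0 by rewrite compDr compNr e subrr.
  have [x [ex _]] := uk _ _ fd.
  have x0 : x = 0 by case: (zZ W) => _ /(_ x).
  by apply/subr0_eq; rewrite -ex x0 compm0.
by case: (sS' _ _ fmono).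
Qed.

(** Left composition with [f] acts on the finite-dimensional space [Hom S S] and has an eigenvector.
    For its eigenvalue [a], the difference [f - a *: idm S] kills a nonzero morphism, so it is not
    invertible and vanishes by [simple_hom_iso]. *)
Lemma simple_endo S (f : Hom S S) : simple S -> exists a, f = a *: idm S.
Proof.
move=> sS; pose V := Hom S S; pose n := dim V.
pose phi (r : 'rV[K]_n) : 'rV[K]_n := v2r (f \oc (@r2v _ V r)).
have lphi a u v : phi (a *: u + v) = a *: phi u + phi v.
  by rewrite /phi linearP comp_linr linearP.
pose pl := GRing.isLinear.Build K _ _ *:%R phi lphi.
pose Phi : {linear 'rV[K]_n -> 'rV[K]_n} := HB.pack phi pl.
have n0 : (0 < n)%N.
  rewrite lt0n; apply/eqP => e.
  have /eqP[] := simple_idm_neq0 sS.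
  apply: (can_inj v2rK); rewrite linear0.
  by apply/rowP => i; suff: (i < 0)%N by []; rewrite -e.
have [a /eigenvalueP [r er r0]] := eigenvalue_closed (lin1_mx Phi) n0.
exists a; apply/subr0_eq/eqP; apply: contraT => nz.
have [g [gf _]] := simple_hom_iso sS sS nz.
have : (f - a *: idm S) \oc (@r2v _ V r) = 0.
  rewrite compDl compNl compZl comp1m; apply/eqP; rewrite subr_eq0.
  by rewrite -linearZ -er mul_rV_lin1 /= /phi v2rK.
move/(congr1 (fun u => g \oc u)); rewrite compA gf comp1m compm0 => /eqP.
by rewrite -(linear0 (@r2v _ V)) (inj_eq (can_inj r2vK)) (negPf r0).
Qed.

Lemma simple_hom_scalar S S' (phi f : Hom S S') :
  simple S -> is_iso phi -> exists a, f = a *: phi.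
Proof.
move=> sS [g [gp pg]]; have [a e] := simple_endo (g \oc f) sS.
by exists a; rewrite -[f]comp1m -pg -compA e compZr compm1.
Qed.

Lemma hom_nonisomorphic S S' (f : Hom S S') :
  simple S -> simple S' -> ~ isomorphic S S' -> f = 0.
Proof.
move=> s s' n; apply/eqP/negPn/negP => f0; apply: n.
by exists f; apply: simple_hom_iso.
Qed.

Lemma dim_hom_basis (V : vectType K) (I : finType) (P : pred I) (b : I -> V)
   (c : I -> V -> K) :
  (forall i, P i -> forall (a : I -> K),
     \sum_(j | P j) a j *: b j = 0 -> a i = 0) ->
  (forall v, v = \sum_(j | P j) c j v *: b j) -> \dim {: V} = #|P|.
Proof.
move=> fr sp.
pose s := [seq b i | i <- enum P].
have sz : size s = #|P| by rewrite size_map -cardE.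
rewrite -sz; apply/eqP; rewrite eq_sym.
have sp' : <<s>>%VS = fullv.
  apply/vspaceP => v; rewrite memvf (sp v); apply: memv_suml => j Pj.
  by rewrite memvZ// memv_span// map_f// mem_enum.
suff fs : free s by move: fs; rewrite /free sp'  eq_sym.
apply/freeP => a ea i.
have i_lt : (i < size (enum P))%N by rewrite -cardE.
case: (pickP P) => [x0 Px0|P0]; last first.
  by have := leq_ltn_trans (leq0n i) (ltn_ord i); rewrite eq_card0.
pose x := nth x0 (enum P) i.
have Px : P x by have := mem_nth x0 i_lt; rewrite mem_enum.
(* The coefficients [a] are attached to positions in [enum P]; [a'] moves them to [I], with value 0
   off [P]. *)
pose a' (j : I) := if insub (index j (enum P)) is Some k then a k else 0.
have a'E (k : 'I_#|P|) : a' (nth x0 (enum P) k) = a k.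
  have k_lt : (k < size (enum P))%N by rewrite -cardE.
  by rewrite /a' index_uniq ?enum_uniq// valK.
rewrite -a'E; apply: (fr _ Px a').
rewrite -[RHS]ea -big_enum /= (big_nth x0) big_mkord -cardE.
apply: eq_bigr => k _; rewrite a'E (nth_map x0) //.
by rewrite -cardE.
Qed.

(** By Schur's lemma the components of a morphism [S -> Z] vanish off the copies of [S] and are
    multiples of a fixed isomorphism on them, so the [inj k \oc phi k] over these copies form a
    basis. *)
Lemma dim_hom_to_sum S n (F : 'I_n -> C) Z :
  simple S -> (forall k, simple (F k)) -> direct_sum F Z ->
  \dim {: Hom S Z} = #|[pred k | `[< isomorphic (F k) S >]]|.
Proof.
move=> sS sF [inj [prj [h1 h2 h3]]].
(* The value 0 is a placeholder where [F k] is not isomorphic to [S]. *)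
have /all_tag [phi phiP] k :
    { phi : Hom S (F k) | isomorphic (F k) S -> is_iso phi }.
  apply: constructive_indefinite_description.
  case: (EM (isomorphic (F k) S)) => [/isomorphic_sym [phi]|n1].
    by exists phi.
  by exists 0.
have /all_tag [c cP] k : { c : Hom S Z -> K | isomorphic (F k) S ->
    forall v, prj k \oc v = c v *: phi k }.
  apply: constructive_indefinite_description.
  case: (EM (isomorphic (F k) S)) => [i|n1]; last by exists (fun=> 0).
  have sc v := simple_hom_scalar (prj k \oc v) sS (phiP k i).
  by have [c cP] := boolp.choice sc; exists c.
apply: (@dim_hom_basis _ _ _ (fun k => inj k \oc phi k) c).
  move=> k /asboolP kS a e.
  have := congr1 (fun u => prj k \oc u) e.
  rewrite compm0 comp_sumr (bigD1 k) ?big1 /=; first last.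
  - by apply/asboolP.
  - by move=> l /andP[_ lk]; rewrite compZr compA h2 ?comp0m ?scaler0// eq_sym.
  rewrite addr0 compZr compA h1 comp1m => /eqP; rewrite scaler_eq0.
  case/orP => [/eqP//|/eqP p0].
  have [g [gp _]] := phiP k kS.
  by have /eqP[] := simple_idm_neq0 sS; rewrite -gp p0 compm0.
move=> v; rewrite -{1}[v]comp1m -h3 comp_suml
  (bigID (fun k => `[< isomorphic (F k) S >])) /=.
rewrite [X in _ + X]big1 ?addr0 => [|k /asboolP nk]; last first.
  rewrite -compA (hom_nonisomorphic (prj k \oc v)) ?compm0// => /isomorphic_sym.
  exact: nk.
by apply: eq_bigr => k /asboolP kS; rewrite -compA cP// compZr.
Qed.

(** The dual argument, with basis [phi k \oc prj k]. With [dim_hom_to_sum] it makes Hom dimensions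
    symmetric. *)
Lemma dim_hom_from_sum S n (F : 'I_n -> C) Z :
  simple S -> (forall k, simple (F k)) -> direct_sum F Z ->
  \dim {: Hom Z S} = #|[pred k | `[< isomorphic (F k) S >]]|.
Proof.
move=> sS sF [inj [prj [h1 h2 h3]]].
have /all_tag [phi phiP] k :
    { phi : Hom (F k) S | isomorphic (F k) S -> is_iso phi }.
  apply: constructive_indefinite_description.
  case: (EM (isomorphic (F k) S)) => [[phi]|n1].
    by exists phi.
  by exists 0.
have /all_tag [c cP] k : { c : Hom Z S -> K | isomorphic (F k) S ->
    forall v, v \oc inj k = c v *: phi k }.
  apply: constructive_indefinite_description.
  case: (EM (isomorphic (F k) S)) => [i|n1]; last by exists (fun=> 0).
  have sc v := simple_hom_scalar (v \oc inj k) (sF k) (phiP k i).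
  by have [c cP] := boolp.choice sc; exists c.
apply: (@dim_hom_basis _ _ _ (fun k => phi k \oc prj k) c).
  move=> k /asboolP kS a e.
  have := congr1 (fun u => u \oc inj k) e.
  rewrite comp0m comp_suml (bigD1 k) ?big1 /=; first last.
  - by apply/asboolP.
  - by move=> l /andP[_ lk]; rewrite compZl -compA h2 ?compm0 ?scaler0.
  rewrite addr0 compZl -compA h1 compm1 => /eqP; rewrite scaler_eq0.
  case/orP => [/eqP//|/eqP p0].
  have [g [_ pg]] := phiP k kS.
  by have /eqP[] := simple_idm_neq0 sS; rewrite -pg p0 comp0m.
move=> v; rewrite -{1}[v]compm1 -h3 comp_sumr
  (bigID (fun k => `[< isomorphic (F k) S >])) /=.
rewrite [X in _ + X]big1 ?addr0 => [|k /asboolP nk]; last first.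
  by rewrite compA (hom_nonisomorphic (v \oc inj k)) ?comp0m.
by apply: eq_bigr => k /asboolP kS; rewrite compA cP// compZl.
Qed.

End Schur.

(** * Coherence and duality *)

Section Coherence.
Context {K : fieldType} {C : monCat K}.
Implicit Types X Y Z W A B D : C.

(** Left whiskering; [rw] is right whiskering. *)
Definition lw X Y Z (f : Hom Y Z) : Hom (X \ot Y) (X \ot Z) := idm X \om f.
Definition rw X Y (f : Hom X Y) Z : Hom (X \ot Z) (Y \ot Z) := f \om idm Z.

Lemma lw_comp X Y Z W (g : Hom Z W) (f : Hom Y Z) :
  lw X (g \oc f) = lw X g \oc lw X f.
Proof. by rewrite /lw -tensm_comp comp1m. Qed.

Lemma rw_comp X Y Z W (g : Hom Y Z) (f : Hom X Y) :
  rw (g \oc f) W = rw g W \oc rw f W.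
Proof. by rewrite /rw -tensm_comp comp1m. Qed.

Lemma lw_id X Y : lw X (idm Y) = idm (X \ot Y).
Proof. exact: tensm_id. Qed.

Lemma rw_id X Y : rw (idm X) Y = idm (X \ot Y).
Proof. exact: tensm_id. Qed.

Lemma lwZ X Y Z a (f : Hom Y Z) : lw X (a *: f) = a *: lw X f.
Proof.
have l0 : lw X (0 : Hom Y Z) = 0.
  have := tensm_linr 1 (idm X) (0 : Hom Y Z) 0.
  by rewrite !scale1r addr0 -[LHS]addr0 => /addrI.
by rewrite /lw -[a *: f]addr0 tensm_linr -/(lw X 0) l0 addr0.
Qed.

Lemma rwZ X Y Z a (f : Hom X Y) : rw (a *: f) Z = a *: rw f Z.
Proof.
have l0 : rw (0 : Hom X Y) Z = 0.
  have := tensm_linl 1 (0 : Hom X Y) 0 (idm Z).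
  by rewrite !scale1r addr0 -[LHS]addr0 => /addrI.
by rewrite /rw -[a *: f]addr0 tensm_linl -/(rw 0 Z) l0 addr0.
Qed.

Lemma rwD X Y Z (f g : Hom X Y) : rw (f + g) Z = rw f Z + rw g Z.
Proof. by have := tensm_linl 1 f g (idm Z); rewrite !scale1r. Qed.

Lemma lwD X Y Z (f g : Hom Y Z) : lw X (f + g) = lw X f + lw X g.
Proof. by have := tensm_linr 1 (idm X) f g; rewrite !scale1r. Qed.

Lemma rw_lw X Y Z W (f : Hom X Y) (g : Hom Z W) :
  rw f W \oc lw X g = lw Y g \oc rw f Z.
Proof. by rewrite /rw /lw -!tensm_comp !comp1m !compm1. Qed.

Lemma assocVK X Y Z W (f : Hom W _) : assoc' X Y Z \oc assoc X Y Z \oc f = f.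
Proof. by rewrite compA (assocK X Y Z).1 comp1m. Qed.
Lemma assocKV X Y Z W (f : Hom W _) : assoc X Y Z \oc assoc' X Y Z \oc f = f.
Proof. by rewrite compA (assocK X Y Z).2 comp1m. Qed.
Lemma lunitKV X W (f : Hom W _) : lunit X \oc lunit' X \oc f = f.
Proof. by rewrite compA (lunitK X).2 comp1m. Qed.

Lemma comp_inj X Y Z (g : Hom Y Z) g' (u v : Hom X Y) :
  g' \oc g = idm Y -> g \oc u = g \oc v -> u = v.
Proof. by move=> gK e; rewrite -[u]comp1m -[v]comp1m -gK -?compA e. Qed.

Lemma comp_injr X Y Z (g : Hom X Y) g' (u v : Hom Y Z) :
  g \oc g' = idm Y -> u \oc g = v \oc g -> u = v.
Proof. by move=> gK e; rewrite -[u]compm1 -[v]compm1 -gK !compA e. Qed.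

Lemma assoc_rr X X' Y Z (f : Hom X X') :
  assoc X' Y Z \oc rw (rw f Y) Z = rw f (Y \ot Z) \oc assoc X Y Z.
Proof. by rewrite /rw assoc_nat tensm_id. Qed.

Lemma assoc_lr X Y Y' Z (f : Hom Y Y') :
  assoc X Y' Z \oc rw (lw X f) Z = lw X (rw f Z) \oc assoc X Y Z.
Proof. by rewrite /rw /lw assoc_nat. Qed.

Lemma assoc_ll X Y Z Z' (f : Hom Z Z') :
  assoc X Y Z' \oc lw (X \ot Y) f = lw X (lw Y f) \oc assoc X Y Z.
Proof. by rewrite /lw -tensm_id assoc_nat. Qed.

Lemma assoc'_swap X X' Y Y' Z Z' (u : Hom ((X \ot Y) \ot Z) ((X' \ot Y') \ot Z')) v :
  assoc X' Y' Z' \oc u = v \oc assoc X Y Z -> u \oc assoc' X Y Z = assoc' X' Y' Z' \oc v.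
Proof.
move=> e; rewrite -[u in LHS]comp1m -(assocK _ _ _).1 -?compA (compR e) -compA.
by rewrite (assocK _ _ _).2 compm1.
Qed.

Lemma assoc'_rr X X' Y Z (f : Hom X X') :
  rw (rw f Y) Z \oc assoc' X Y Z = assoc' X' Y Z \oc rw f (Y \ot Z).
Proof. exact/assoc'_swap/assoc_rr. Qed.

Lemma assoc'_lr X Y Y' Z (f : Hom Y Y') :
  rw (lw X f) Z \oc assoc' X Y Z = assoc' X Y' Z \oc lw X (rw f Z).
Proof. exact/assoc'_swap/assoc_lr. Qed.

Lemma assoc'_ll X Y Z Z' (f : Hom Z Z') :
  lw (X \ot Y) f \oc assoc' X Y Z = assoc' X Y Z' \oc lw X (lw Y f).
Proof. exact/assoc'_swap/assoc_ll. Qed.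

Lemma pent W X Y Z : assoc W X (Y \ot Z) \oc assoc (W \ot X) Y Z
  = lw W (assoc X Y Z) \oc assoc W (X \ot Y) Z \oc rw (assoc W X Y) Z.
Proof. exact: pentagon. Qed.

Lemma pentR V W X Y Z (r : Hom V _) :
  lw W (assoc X Y Z) \oc assoc W (X \ot Y) Z \oc rw (assoc W X Y) Z \oc r
  = assoc W X (Y \ot Z) \oc assoc (W \ot X) Y Z \oc r.
Proof. by rewrite (compA (assoc W X _)) pent -?compA. Qed.

Lemma rw_assocK W X Y Z : rw (assoc W X Y) Z \oc rw (assoc' W X Y) Z = idm _.
Proof. by rewrite -rw_comp (assocK _ _ _).2 rw_id. Qed.

Lemma rw_assocVK W X Y Z : rw (assoc' W X Y) Z \oc rw (assoc W X Y) Z = idm _.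
Proof. by rewrite -rw_comp (assocK _ _ _).1 rw_id. Qed.

Lemma pent_rw W X Y Z : lw W (assoc X Y Z) \oc assoc W (X \ot Y) Z
  = assoc W X (Y \ot Z) \oc assoc (W \ot X) Y Z \oc rw (assoc' W X Y) Z.
Proof. by rewrite (compR (pent _ _ _ _)) -?compA rw_assocK compm1. Qed.

Lemma pent_a W X Y Z : assoc (W \ot X) Y Z \oc rw (assoc' W X Y) Z
  = assoc' W X (Y \ot Z) \oc lw W (assoc X Y Z) \oc assoc W (X \ot Y) Z.
Proof. by rewrite pent_rw assocVK. Qed.

Lemma pent_b W X Y Z :
  assoc W (X \ot Y) Z \oc rw (assoc W X Y) Z \oc assoc' (W \ot X) Y Z
  = lw W (assoc' X Y Z) \oc assoc W X (Y \ot Z).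
Proof.
have i : lw W (assoc' X Y Z) \oc lw W (assoc X Y Z) = idm _.
  by rewrite -lw_comp (assocK _ _ _).1 lw_id.
apply: (comp_inj i).
rewrite pentR (assocK _ _ _).2 compm1 compA -lw_comp (assocK _ _ _).2.
by rewrite lw_id comp1m.
Qed.

Lemma runit_rw X Y : rw (runit X) Y = lw X (lunit Y) \oc assoc X unit_ob Y.
Proof. by rewrite /rw -triangle. Qed.

Lemma lunitN X Y (f : Hom X Y) : lunit Y \oc lw unit_ob f = f \oc lunit X.
Proof. exact: lunit_nat. Qed.

Lemma lunit'N X Y (f : Hom X Y) : lw unit_ob f \oc lunit' X = lunit' Y \oc f.
Proof.
apply: (comp_inj (lunitK Y).1).
by rewrite lunitKV (compR (lunitN f)) -compA (lunitK X).2 compm1.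
Qed.

(** The left unitor is a natural isomorphism to the identity functor, so tensoring with the unit is
    faithful. *)
Lemma lw_inj X Y (f g : Hom X Y) : lw unit_ob f = lw unit_ob g -> f = g.
Proof.
move=> e; apply: (comp_injr (lunitK X).2).
by rewrite -!lunitN e.
Qed.

(* Kelly: a consequence of the pentagon and the triangle. *)
Lemma lunit_tens X Y : lunit (X \ot Y) \oc assoc unit_ob X Y = rw (lunit X) Y.
Proof.
apply: lw_inj.
have i1 : (assoc unit_ob (unit_ob \ot X) Y \oc rw (assoc unit_ob unit_ob X) Y)
    \oc (rw (assoc' unit_ob unit_ob X) Y \oc assoc' unit_ob (unit_ob \ot X) Y) = idm _.
  by rewrite -?compA (compR (rw_assocK _ _ _ _)) comp1m (assocK _ _ _).2.
apply: (comp_injr i1).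
rewrite lw_comp -?compA -pent compA -runit_rw (compR (esym (assoc_lr _ _ _))).
by rewrite -compA -rw_comp -runit_rw assoc_rr.
Qed.

Lemma lunit'_tens X Y : assoc unit_ob X Y \oc rw (lunit' X) Y = lunit' (X \ot Y).
Proof.
apply: (comp_inj (lunitK _).1).
by rewrite compA lunit_tens -rw_comp (lunitK _).2 rw_id (lunitK _).2.
Qed.

Lemma runit'_rw X Y : assoc X unit_ob Y \oc rw (runit' X) Y = lw X (lunit' Y).
Proof.
have i : lw X (lunit' Y) \oc lw X (lunit Y) = idm _.
  by rewrite -lw_comp (lunitK _).1 lw_id.
apply: (comp_inj i).
by rewrite compA -runit_rw -rw_comp -lw_comp (runitK _).2 (lunitK _).2 rw_id lw_id.
Qed.

(* Diagrams are drawn on objects A (x) (B (x) ( ... (x) Z)) with a free last factor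
   Z, on which composition of diagrams involves no associators.  The definitions
   are locked so that rewriting with [lw_comp] or [rw_comp] leaves them alone. *)
Definition in2 A B (f : Hom unit_ob (A \ot B)) Z : Hom Z (A \ot (B \ot Z)) :=
  locked (assoc A B Z \oc rw f Z \oc lunit' Z).
Definition out2 A B (f : Hom (A \ot B) unit_ob) Z : Hom (A \ot (B \ot Z)) Z :=
  locked (lunit Z \oc rw f Z \oc assoc' A B Z).
Definition mid2 A B A' B' (f : Hom (A \ot B) (A' \ot B')) Z :
    Hom (A \ot (B \ot Z)) (A' \ot (B' \ot Z)) :=
  locked (assoc A' B' Z \oc rw f Z \oc assoc' A B Z).

Lemma in2E A B (f : Hom unit_ob (A \ot B)) Z :
  in2 f Z = assoc A B Z \oc rw f Z \oc lunit' Z.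
Proof. by rewrite /in2 -lock. Qed.

Lemma out2E A B (f : Hom (A \ot B) unit_ob) Z :
  out2 f Z = lunit Z \oc rw f Z \oc assoc' A B Z.
Proof. by rewrite /out2 -lock. Qed.

Lemma mid2E A B A' B' (f : Hom (A \ot B) (A' \ot B')) Z :
  mid2 f Z = assoc A' B' Z \oc rw f Z \oc assoc' A B Z.
Proof. by rewrite /mid2 -lock. Qed.

Lemma in2N A B (f : Hom unit_ob (A \ot B)) Z Z' (g : Hom Z Z') :
  lw A (lw B g) \oc in2 f Z = in2 f Z' \oc g.
Proof.
rewrite !in2E (compR (esym (assoc_ll _ _ _))) -?compA.
by rewrite (compR (esym (rw_lw _ _))) -compA lunit'N.
Qed.

Lemma out2N A B (f : Hom (A \ot B) unit_ob) Z Z' (g : Hom Z Z') :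
  out2 f Z' \oc lw A (lw B g) = g \oc out2 f Z.
Proof.
by rewrite !out2E -?compA -assoc'_ll (compR (rw_lw _ _)) -compA
  (compR (lunitN _)) -compA.
Qed.

Lemma in2NR V X A B (f : Hom unit_ob (A \ot B)) Z Z' (g : Hom Z Z')
    (r : Hom V (X \ot Z)) :
  lw X (lw A (lw B g)) \oc lw X (in2 f Z) \oc r
  = lw X (in2 f Z') \oc lw X g \oc r.
Proof. by rewrite !(compR (esym (lw_comp _ _ _))) in2N. Qed.

Lemma mid2N A B A' B' (f : Hom (A \ot B) (A' \ot B')) Z Z' (g : Hom Z Z') :
  mid2 f Z' \oc lw A (lw B g) = lw A' (lw B' g) \oc mid2 f Z.
Proof.
rewrite !mid2E -?compA -assoc'_ll (compR (rw_lw _ _)) -?compA.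
by rewrite (compR (assoc_ll _ _ _)) -compA.
Qed.

Lemma mid2_comp A B A' B' A2 B2 (g : Hom (A' \ot B') (A2 \ot B2))
    (f : Hom (A \ot B) (A' \ot B')) Z : mid2 (g \oc f) Z = mid2 g Z \oc mid2 f Z.
Proof. by rewrite !mid2E -?compA assocVK rw_comp -?compA. Qed.

Lemma mid2_assoc A B A' B' (f : Hom (A \ot B) (A' \ot B')) Z :
  mid2 f Z \oc assoc A B Z = assoc A' B' Z \oc rw f Z.
Proof. by rewrite mid2E -?compA (assocK _ _ _).1 compm1. Qed.

Lemma mid2_id A B Z : mid2 (idm (A \ot B)) Z = idm _.
Proof. by rewrite !mid2E rw_id comp1m (assocK _ _ _).2. Qed.

Lemma out2_mid2 A B A' B' (g : Hom (A' \ot B') unit_ob)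
    (f : Hom (A \ot B) (A' \ot B')) Z : out2 (g \oc f) Z = out2 g Z \oc mid2 f Z.
Proof. by rewrite !mid2E !out2E -?compA assocVK rw_comp -?compA. Qed.

Lemma mid2_in2 A B A' B' (g : Hom (A \ot B) (A' \ot B'))
    (f : Hom unit_ob (A \ot B)) Z : in2 (g \oc f) Z = mid2 g Z \oc in2 f Z.
Proof. by rewrite !mid2E !in2E -?compA assocVK rw_comp -?compA. Qed.

Lemma out2_in2 A B (g : Hom (A \ot B) unit_ob) (f : Hom unit_ob (A \ot B)) Z :
  out2 g Z \oc in2 f Z = lunit Z \oc rw (g \oc f) Z \oc lunit' Z.
Proof. by rewrite !out2E !in2E -?compA assocVK rw_comp -?compA. Qed.

Lemma mid2_rw A B A' (f : Hom A A') Z : mid2 (rw f B) Z = rw f (B \ot Z).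
Proof. by rewrite !mid2E assoc'_rr assocKV. Qed.

Lemma mid2_lw A B B' (f : Hom B B') Z : mid2 (lw A f) Z = lw A (rw f Z).
Proof. by rewrite !mid2E assoc'_lr assocKV. Qed.

Lemma out2_mod A B (f : Hom (A \ot B) unit_ob) Z W :
  rw (out2 f Z) W
    = out2 f (Z \ot W) \oc lw A (assoc B Z W) \oc assoc A (B \ot Z) W.
Proof.
rewrite pent_rw !out2E -?compA assocVK (compR (esym (assoc_rr _ _ _))) -?compA.
by rewrite (compR (lunit_tens _ _)) !rw_comp.
Qed.

Lemma in2_mod A B (f : Hom unit_ob (A \ot B)) Z W :
  lw A (assoc B Z W) \oc assoc A (B \ot Z) W \oc rw (in2 f Z) W = in2 f (Z \ot W).
Proof.
rewrite (compR (pent_rw _ _ _ _)) !in2E !rw_comp -?compA (compR (rw_assocVK _ _ _ _)).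
by rewrite comp1m (compR (assoc_rr _ _ _)) -compA lunit'_tens.
Qed.

Lemma mid2_mod A B A' B' (f : Hom (A \ot B) (A' \ot B')) Z W :
  lw A' (assoc B' Z W) \oc assoc A' (B' \ot Z) W \oc rw (mid2 f Z) W
   = mid2 f (Z \ot W) \oc lw A (assoc B Z W) \oc assoc A (B \ot Z) W.
Proof.
rewrite (compR (pent_rw _ _ _ _)) pent_rw !mid2E !rw_comp -?compA.
rewrite (compR (rw_assocVK _ _ _ _)) comp1m assocVK.
by rewrite (compR (assoc_rr _ _ _)) -?compA.
Qed.

(* By [modfam_rw], such a family is right whiskering by a single morphism. *)
Definition modfam A B (P : forall Z, Hom (A \ot Z) (B \ot Z)) : Prop :=
  (forall Z W (g : Hom Z W), P W \oc lw A g = lw B g \oc P Z) /\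
  (forall Z W, P (Z \ot W) \oc assoc A Z W = assoc B Z W \oc rw (P Z) W).

(** Compatibility with tensor products determines [P] at [unit_ob \ot Z] from its value at the unit;
    naturality along the unitor carries this to [Z]. *)
Lemma modfam_rw A B (P : forall Z, Hom (A \ot Z) (B \ot Z)) : modfam P ->
  forall Z, P Z = rw (runit B \oc P unit_ob \oc runit' A) Z.
Proof.
case=> [nat mod] Z; rewrite !rw_comp runit_rw -?compA.
rewrite (compR (esym (mod _ _))) -?compA runit'_rw (compR (esym (nat _ _ _))).
by rewrite -compA -lw_comp (lunitK _).2 lw_id compm1.
Qed.

(** The two zigzag identities beside a free factor [Z], where no associator appears. *)
Record fdual X D (e : Hom (D \ot X) unit_ob) (c : Hom unit_ob (X \ot D)) : Prop :=
  FDual {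
    fzig : forall Z, lw X (out2 e Z) \oc in2 c (X \ot Z) = idm _;
    fzag : forall Z, out2 e (D \ot Z) \oc lw D (in2 c Z) = idm _ }.

(** Each zigzag identity is tensored with [Z] on the right; the pentagon and the coherences of the
    unitors absorb the associators. *)
Lemma fdualP X D (e : Hom (D \ot X) unit_ob) (c : Hom unit_ob (X \ot D)) :
  is_left_dual e c -> fdual e c.
Proof.
case=> [zig zag]; split=> Z.
  rewrite -rw_id -zig -/(lw X e) -/(rw c X) !rw_comp.
  rewrite runit_rw -?compA (compR (assoc_lr _ _ _)) -?compA.
  rewrite !out2E !lw_comp !in2E -?compA; congr (_ \oc (_ \oc _)).
  rewrite -lunit'_tens (compR (esym (assoc_rr _ _ _))) -?compA.
  rewrite (compR (pent _ _ _ _)) -?compA.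
  by rewrite (compR (_ : lw X (assoc' _ _ _) \oc lw X (assoc _ _ _) = idm _)) ?comp1m
    // -lw_comp (assocK _ _ _).1 lw_id.
rewrite -rw_id -zag -/(lw D c) -/(rw e D) !rw_comp.
apply: esym.
have r'E : rw (runit' D) Z = assoc' D unit_ob Z \oc lw D (lunit' Z).
  by apply: (comp_inj (assocK _ _ _).1); rewrite assocKV runit'_rw.
rewrite r'E (compR (assoc'_lr _ _ _)) -?compA.
rewrite -lunit_tens -?compA (compR (assoc_rr _ _ _)) -?compA.
rewrite !out2E !in2E !lw_comp -?compA; congr (_ \oc (_ \oc _)).
by rewrite (compR (pent_a _ _ _ _)) -?compA assocKV.
Qed.

(** * Duals of tensor products *)

Section ProductDual.
Context {X D : C} (e : Hom (D \ot X) unit_ob) (c : Hom unit_ob (X \ot D)).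
Context {X' D' : C} (e' : Hom (D' \ot X') unit_ob) (c' : Hom unit_ob (X' \ot D')).
Hypotheses (dX : fdual e c) (dX' : fdual e' c').

(** The caps are nested with [e] inside [e'], which is why the duals appear in reverse order. *)
Definition prod_ev : Hom ((D' \ot D) \ot (X \ot X')) unit_ob :=
  e' \oc lw D' (out2 e X') \oc assoc D' D (X \ot X').
Definition prod_coev : Hom unit_ob ((X \ot X') \ot (D' \ot D)) :=
  assoc' X X' (D' \ot D) \oc lw X (in2 c' D) \oc c.

Lemma prod_evE Z : out2 prod_ev Z = out2 e' Z \oc lw D' (out2 e (X' \ot Z))
  \oc lw D' (lw D (assoc X X' Z)) \oc assoc D' D ((X \ot X') \ot Z).
Proof.
rewrite {1}out2E /prod_ev !rw_comp -?compA.
rewrite (out2E e' Z) -?compA; congr (_ \oc (_ \oc _)).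
apply: (comp_inj (assocK _ _ _).1).
rewrite assocKV (compR (assoc_lr _ _ _)) -?compA out2_mod !lw_comp -?compA.
by rewrite pentR (assocK _ _ _).2 compm1.
Qed.

Lemma prod_coevE Z :
  lw X (lw X' (assoc D' D Z)) \oc assoc X X' ((D' \ot D) \ot Z) \oc in2 prod_coev Z
  = lw X (in2 c' (D \ot Z)) \oc in2 c Z.
Proof.
rewrite {1}in2E /prod_coev !rw_comp -?compA (compR (pent _ _ _ _)) -?compA.
rewrite (compR (rw_assocK _ _ _ _)) comp1m (compR (assoc_lr _ _ _)) -?compA.
by rewrite -in2_mod !lw_comp (in2E c Z) -?compA.
Qed.

Lemma prod_fdual : fdual prod_ev prod_coev.
Proof.
split=> Z.
  apply: (comp_inj (assocK X X' Z).1); rewrite compm1 (compR (assoc_ll _ _ _)).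
  rewrite prod_evE !lw_comp -?compA prod_coevE.
  rewrite in2NR in2N in2NR (compR (esym (lw_comp _ _ _))) (fzig dX') lw_id comp1m.
  by rewrite (compR (fzig dX _)) comp1m.
apply: (comp_inj (assocK D' D Z).1); rewrite compm1.
rewrite (compR (esym (out2N prod_ev (assoc D' D Z)))) -?compA -lw_comp.
rewrite prod_evE -?compA assoc_ll.
rewrite !(compR (esym (lw_comp D' _ _))) -?compA -lw_comp (compR (assoc_ll _ _ _)).
rewrite -?compA prod_coevE (lw_comp D) (compR (out2N _ _)) -?compA (fzag dX) compm1.
by rewrite (compR (fzag dX' _)) comp1m.
Qed.
End ProductDual.

(** * Transposes and their passage through caps and cups *)

Section DualChange.
Context {X D : C} {e : Hom (D \ot X) unit_ob} {c : Hom unit_ob (X \ot D)}.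
Context {X' D' : C} {e' : Hom (D' \ot X') unit_ob} {c' : Hom unit_ob (X' \ot D')}.
Hypotheses (dX : fdual e c) (dX' : fdual e' c').

(** [phi] is the transpose of [f], made by bending its strand with [c'] and [e]. [P] is this diagram
    beside [Z], a whiskering by [modfam_rw]; the zigzag identities give both equations. *)
Lemma fdual_transpose (f : Hom X' X) : exists phi : Hom D D', forall Z,
  out2 e Z \oc lw D (rw f Z) = out2 e' Z \oc rw phi (X' \ot Z) /\
  rw f (D' \ot Z) \oc in2 c' Z = lw X (rw phi Z) \oc in2 c Z.
Proof.
pose P Z := out2 e (D' \ot Z) \oc lw D (rw f (D' \ot Z)) \oc lw D (in2 c' Z).
have Pm : modfam P.
  split=> [Z W g|Z W].
    rewrite /P -?compA -lw_comp -in2N -lw_comp (compR (rw_lw _ _)) -?compA.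
    by rewrite lw_comp (compR (out2N _ _)) -?compA lw_comp.
  rewrite /P !rw_comp out2_mod -?compA.
  rewrite (compR (assoc_lr _ _ _)) -?compA assoc_lr.
  rewrite (compR (esym (out2N _ _))) -?compA; congr (_ \oc _).
  rewrite !compA; congr (_ \oc _); rewrite -!lw_comp -?compA; congr (lw _ _).
  rewrite (compR (assoc_rr _ _ _)) -?compA (compR (esym (rw_lw _ _))) -?compA.
  by rewrite in2_mod.
exists (runit D' \oc P unit_ob \oc runit' D) => Z; rewrite -!(modfam_rw Pm) /P.
split.
  rewrite (compR (esym (out2N _ _))) -?compA -!lw_comp.
  by rewrite (compR (esym (rw_lw _ _))) -?compA (fzig dX') compm1.
rewrite !lw_comp -?compA in2N (compR (in2N _ _)) -?compA.
by rewrite (compR (fzig dX _)) comp1m.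
Qed.

End DualChange.

End Coherence.

(** * Braiding and traces *)

Section Braided.
Context {K : fieldType} {C : premodularCat K}.
Implicit Types X Y Z W A B D : C.

Notation b X Y Z := (mid2 (braid X Y) Z).

Lemma braid_rw X X' Y (f : Hom X X') :
  braid X' Y \oc rw f Y = lw Y f \oc braid X Y.
Proof. exact: braid_nat. Qed.

Lemma braid_lw X Y Y' (f : Hom Y Y') :
  braid X Y' \oc lw X f = rw f X \oc braid X Y.
Proof. exact: braid_nat. Qed.

Lemma b_rw X X' Y (f : Hom X X') Z :
  b X' Y Z \oc rw f (Y \ot Z) = lw Y (rw f Z) \oc b X Y Z.
Proof. by rewrite -mid2_rw -mid2_lw -!mid2_comp braid_rw. Qed.

Lemma b_lw X Y Y' (f : Hom Y Y') Z :
  b X Y' Z \oc lw X (rw f Z) = rw f (X \ot Z) \oc b X Y Z.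
Proof. by rewrite -mid2_rw -mid2_lw -!mid2_comp braid_lw. Qed.

(** The hexagon axiom beside [Z]: the only associators left are those that regroup [Y] and [Y'] with
    what follows. *)
Lemma hex1 X Y Y' Z : assoc Y Y' (X \ot Z) \oc b X (Y \ot Y') Z
  = lw Y (b X Y' Z) \oc b X Y (Y' \ot Z) \oc lw X (assoc Y Y' Z).
Proof.
have h : assoc Y Y' X \oc braid X (Y \ot Y')
    = lw Y (braid X Y') \oc assoc Y X Y' \oc rw (braid X Y) Y' \oc assoc' X Y Y'.
  apply: (comp_injr (assocK X Y Y').2).
  by rewrite -?compA hexagon1 (assocK _ _ _).1 compm1.
rewrite !mid2E !lw_comp -?compA (compR (pent _ _ _ _)) -?compA.
rewrite (compR (esym (rw_comp _ _ _))) h !rw_comp -?compA.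
rewrite (compR (assoc_lr _ _ _)) -?compA; congr (_ \oc (_ \oc _)).
have i : lw Y (assoc X Y' Z) \oc lw Y (assoc' X Y' Z) = idm _.
  by rewrite -lw_comp (assocK _ _ _).2 lw_id.
have i' : lw Y (assoc' X Y' Z) \oc lw Y (assoc X Y' Z) = idm _.
  by rewrite -lw_comp (assocK _ _ _).1 lw_id.
apply: (comp_inj i'); rewrite (compR i) comp1m pentR.
rewrite (compR (assoc_rr _ _ _)) -?compA (compR (pent_a _ _ _ _)) -?compA.
by rewrite (assocK _ _ _).2 compm1.
Qed.

Lemma hex2 X X' Y Z : lw Y (assoc X X' Z) \oc b (X \ot X') Y Z
  = b X Y (X' \ot Z) \oc lw X (b X' Y Z) \oc assoc X X' (Y \ot Z).
Proof.
have h : braid (X \ot X') Y = assoc Y X X' \oc rw (braid X Y) X'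
    \oc assoc' X Y X' \oc lw X (braid X' Y) \oc assoc X X' Y.
  apply: (comp_inj (assocK Y X X').2); apply: (comp_injr (assocK X X' Y).1).
  rewrite assocVK -?compA hexagon2 -/(lw X _) -/(rw _ X').
  by rewrite (assocK _ _ _).2 compm1.
rewrite !mid2E h !rw_comp !lw_comp -?compA pentR.
rewrite (compR (assoc_rr _ _ _)) -?compA (compR (pent_a _ _ _ _)) -?compA.
by rewrite (compR (assoc_lr _ _ _)) -?compA pent_b.
Qed.

Lemma b_iso X Y Z : exists g, g \oc b X Y Z = idm _ /\ b X Y Z \oc g = idm _.
Proof.
have [g [h1 h2]] := braid_iso X Y; exists (mid2 g Z).
by rewrite -!mid2_comp h1 h2 !mid2_id.
Qed.

(** By the hexagon, crossing [unit_ob \ot unit_ob] is crossing the unit twice; by naturality along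
    the unitor it amounts to crossing it once, and invertibility cancels one crossing. This settles
    the factor [unit_ob \ot W], and naturality gives every [Z]. *)
Lemma lunit_b X Z : lunit (X \ot Z) \oc b X unit_ob Z = lw X (lunit Z).
Proof.
have big W : lunit (X \ot (unit_ob \ot W)) \oc b X unit_ob (unit_ob \ot W)
    = lw X (lunit (unit_ob \ot W)).
  have [g [gb _]] := b_iso X unit_ob W.
  have i : lw X (assoc unit_ob unit_ob W) \oc lw X (assoc' unit_ob unit_ob W) = idm _.
    by rewrite -lw_comp (assocK _ _ _).2 lw_id.
  apply: (comp_inj gb); apply: (comp_injr i); rewrite -?compA -lw_comp.
  rewrite lunit_tens b_lw -lunit_tens -?compA hex1.
  by rewrite (compR (lunitN _)) -?compA.
have i : lw X (lw unit_ob (lunit Z)) \oc lw X (lw unit_ob (lunit' Z)) = idm _.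
  by rewrite -!lw_comp (lunitK _).2 !lw_id.
apply: (comp_injr i); rewrite -?compA mid2N (compR (lunitN _)) -?compA big.
by rewrite -!lw_comp lunitN.
Qed.

(** The two crossings form one crossing of [Y] with [A \ot B]; naturality along [f] turns it into a
    crossing with the unit, which is trivial. *)
Lemma out2_b A B (f : Hom (A \ot B) unit_ob) Y Z :
  out2 f (Y \ot Z) \oc lw A (b Y B Z) \oc b Y A (B \ot Z) = lw Y (out2 f Z).
Proof.
rewrite !out2E !lw_comp -lunit_b -?compA (compR (b_lw _ _ _)) -?compA.
congr (_ \oc (_ \oc _)); apply: (comp_inj (assocK _ _ _).1).
rewrite assocKV (compR (hex1 _ _ _ _)) -?compA -lw_comp (assocK _ _ _).2.
by rewrite lw_id compm1.
Qed.

Lemma theta_prod X Y : twist (X \ot Y)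
  = braid Y X \oc braid X Y \oc lw X (twist Y) \oc rw (twist X) Y.
Proof.
rewrite twist_tens.
have -> : twist X \om twist Y = rw (twist X) Y \oc lw X (twist Y).
  by rewrite /rw /lw -tensm_comp comp1m compm1.
rewrite -rw_lw -?compA (compR (esym (braid_rw _ (twist Y)))) -?compA.
rewrite -(braid_lw X (twist Y)).
rewrite (compR (esym (braid_lw _ _))) -?compA.
by rewrite (compR (esym (braid_rw _ _))) -?compA.
Qed.

(* The right evaluation X (x) X^* -> 1, given the left one. *)
Definition evr X D (e : Hom (D \ot X) unit_ob) : Hom (X \ot D) unit_ob :=
  e \oc braid X D \oc rw (twist X) D.

Lemma out2_evr X D (e : Hom (D \ot X) unit_ob) Z :
  out2 (evr e) Z = out2 e Z \oc b X D Z \oc rw (twist X) (D \ot Z).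
Proof. by rewrite /evr !out2_mid2 mid2_comp mid2_rw. Qed.

Lemma out2_bR V A B (f : Hom (A \ot B) unit_ob) Y Z (r : Hom V _) :
  out2 f (Y \ot Z) \oc lw A (b Y B Z) \oc b Y A (B \ot Z) \oc r
  = lw Y (out2 f Z) \oc r.
Proof. by rewrite -out2_b -?compA. Qed.

Lemma out2_evr' X D (e : Hom (D \ot X) unit_ob) Z :
  out2 (evr e) Z = out2 (e \oc braid X D) Z \oc rw (twist X) (D \ot Z).
Proof. by rewrite out2_evr out2_mid2 -?compA. Qed.

Lemma mid2NR V X A B A' B' (f : Hom (A \ot B) (A' \ot B')) Z Z' (g : Hom Z Z')
    (r : Hom V _) :
  lw X (lw A' (lw B' g)) \oc lw X (mid2 f Z) \oc r
  = lw X (mid2 f Z') \oc lw X (lw A (lw B g)) \oc r.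
Proof. by rewrite !(compR (esym (lw_comp _ _ _))) mid2N. Qed.

(** * Loops and traces coloured by tensor products *)

Section ProductTrace.
Context {X D : C} (e : Hom (D \ot X) unit_ob) (c : Hom unit_ob (X \ot D)).
Context {X' D' : C} (e' : Hom (D' \ot X') unit_ob) (c' : Hom unit_ob (X' \ot D')).

(** The twist of [X \ot X'] contributes a double braiding. The crossings of [X'] with [X] and [D],
    then those of [X] with [X'] and [D'], are absorbed in pairs by pulling a strand across a cap. *)
Lemma prod_evr Z : out2 (evr (prod_ev e e')) Z = out2 (evr e) Z
  \oc lw X (out2 (evr e') (D \ot Z)) \oc lw X (lw X' (assoc D' D Z))
  \oc assoc X X' ((D' \ot D) \ot Z).
Proof.
rewrite out2_evr theta_prod !rw_comp prod_evE -?compA.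
rewrite (compR (hex1 _ _ _ _)) -?compA.
rewrite !(compR (esym (lw_comp D' _ _))) -?compA hex2.
rewrite !(compRR (esym (rw_lw _ (assoc D' D Z)))) -rw_lw.
rewrite (compR (b_rw _ _ _)) -?compA (compR (b_rw _ _ _)) -?compA.
rewrite !(compR (esym (lw_comp D' _ _))) -?compA (compR (esym (mid2_assoc _ _))).
rewrite -?compA -mid2_assoc (compR (esym (out2_mid2 _ _ _))) -?compA.
rewrite out2_bR !lw_comp -?compA (compR (hex2 _ _ _ _)) -?compA.
rewrite (compR (out2N _ _)) -?compA out2_bR.
rewrite (compRR (assoc_lr _ _ _)) (compRR (assoc_rr _ _ _)) assoc_ll.
rewrite !out2_evr' (out2_mid2 e') !lw_comp -?compA.
by rewrite !(compRR (rw_lw (twist X) _)).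
Qed.

(* The loop of X around Y, with the endomorphism a of X inserted. *)
Definition loop X D (e : Hom (D \ot X) unit_ob) (c : Hom unit_ob (X \ot D))
    (a : Hom X X) Y Z : Hom (Y \ot Z) (Y \ot Z) :=
  lw Y (out2 (evr e) Z) \oc b X Y (D \ot Z) \oc b Y X (D \ot Z)
    \oc lw Y (rw a (D \ot Z)) \oc lw Y (in2 c Z).

(** The quantum trace of [a] drawn beside [Z]; see [ftr_qtrace]. *)
Definition ftr X D (e : Hom (D \ot X) unit_ob) (c : Hom unit_ob (X \ot D))
    (a : Hom X X) Z : Hom Z Z :=
  out2 (evr e) Z \oc rw a (D \ot Z) \oc in2 c Z.

(** The hexagons separate the crossings of [Y] with [X] from those with [X'], so the loop of [X']
    ends up inside the loop of [X]. *)
Lemma loop_prod Y Z : loop (prod_ev e e') (prod_coev c c') (idm _) Y Z =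
  lw Y (out2 (evr e) Z) \oc b X Y (D \ot Z)
    \oc lw X (loop e' c' (idm _) Y (D \ot Z)) \oc b Y X (D \ot Z) \oc lw Y (in2 c Z).
Proof.
rewrite /loop !rw_id !lw_id !comp1m prod_evr !lw_comp -?compA.
rewrite (compR (hex2 _ _ _ _)) -?compA (compR (hex1 _ _ _ _)) -?compA.
rewrite !(compRR (esym (mid2N _ _))) !mid2NR !(compRR (esym (mid2N _ _))).
by rewrite -!(lw_comp Y) prod_coevE.
Qed.

Lemma ftr_prod (F : Hom (X \ot X') (X \ot X')) Z :
  ftr (prod_ev e e') (prod_coev c c') F Z = out2 (evr e) Z
    \oc lw X (out2 (evr e') (D \ot Z)) \oc mid2 F (D' \ot (D \ot Z))
    \oc lw X (in2 c' (D \ot Z)) \oc in2 c Z.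
Proof.
rewrite /ftr prod_evr -?compA (compRR (esym (mid2_assoc _ _))).
by rewrite (compRR (esym (mid2N _ _))) prod_coevE.
Qed.

Lemma ftr_prod_id Z al be : (forall W, ftr e c (idm _) W = al *: idm W) ->
  (forall W, ftr e' c' (idm _) W = be *: idm W) ->
  ftr (prod_ev e e') (prod_coev c c') (idm _) Z = (al * be) *: idm Z.
Proof.
move=> h h'; rewrite ftr_prod mid2_id comp1m (compR (esym (lw_comp _ _ _))).
have := h' (D \ot Z); rewrite /ftr rw_id comp1m => ->.
have := h Z; rewrite /ftr rw_id comp1m lwZ lw_id compZl comp1m compZr => ->.
by rewrite scalerA mulrC.
Qed.

(** Closing the strand of [X'] in the double braiding leaves a loop of [X'] around [X], worth [be];
    the remaining closed strand of [X] is worth [al]. *)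
Lemma ftr_prod_dbl Z al be : (forall W, ftr e c (idm _) W = al *: idm W) ->
  (forall W, loop e' c' (idm _) X W = be *: idm _) ->
  ftr (prod_ev e e') (prod_coev c c') (braid X' X \oc braid X X') Z
  = (al * be) *: idm Z.
Proof.
move=> h h'; rewrite ftr_prod mid2_comp -?compA.
have := h' (D \ot Z); rewrite /loop rw_id lw_id comp1m => l.
have -> : forall V (r : Hom V _), lw X (out2 (evr e') (D \ot Z))
    \oc b X' X (D' \ot (D \ot Z)) \oc b X X' (D' \ot (D \ot Z))
    \oc lw X (in2 c' (D \ot Z)) \oc r = be *: r.
  by move=> V r; rewrite -[in RHS](comp1m r) -compZl -l -?compA.
have := h Z; rewrite /ftr rw_id comp1m compZr => ->.
by rewrite scalerA mulrC.
Qed.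

Lemma loop_prod_scalar Y Z al be : (forall W, loop e c (idm _) Y W = al *: idm _) ->
  (forall W, loop e' c' (idm _) Y W = be *: idm _) ->
  loop (prod_ev e e') (prod_coev c c') (idm _) Y Z = (al * be) *: idm _.
Proof.
move=> h h'; rewrite loop_prod h' lwZ lw_id compZl comp1m !compZr.
have := h Z; rewrite /loop rw_id lw_id comp1m => ->.
by rewrite scalerA mulrC.
Qed.

End ProductTrace.

(** * Cyclicity of loops and traces *)

Section Cyclicity.
Context {X D : C} {e : Hom (D \ot X) unit_ob} {c : Hom unit_ob (X \ot D)}.
Context {X' D' : C} {e' : Hom (D' \ot X') unit_ob} {c' : Hom unit_ob (X' \ot D')}.
Hypotheses (dX : fdual e c) (dX' : fdual e' c').

(** [f] slides through the twist and the braiding by naturality, so the transpose of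
    [fdual_transpose] serves the right evaluation as well. *)
Lemma evr_transpose (f : Hom X' X) : exists phi : Hom D D', forall Z,
  out2 (evr e) Z \oc rw f (D \ot Z) = out2 (evr e') Z \oc lw X' (rw phi Z) /\
  rw f (D' \ot Z) \oc in2 c' Z = lw X (rw phi Z) \oc in2 c Z.
Proof.
have [phi phiP] := fdual_transpose dX dX' f; exists phi => Z.
split; last by case: (phiP Z).
rewrite !out2_evr -?compA -rw_comp twist_nat rw_comp (compRR (b_rw _ _ _)).
rewrite (compRR (phiP Z).1) rw_lw.
by rewrite (compRR (b_lw _ _ _)).
Qed.

(** [f] moves along the loop to the cap, passes it as its transpose, and comes back through the cup
    on the other side of [g]. *)
Lemma loop_cyclic (f : Hom X' X) (g : Hom X X') Y Z :
  loop e c (f \oc g) Y Z = loop e' c' (g \oc f) Y Z.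
Proof.
have [phi phiP] := evr_transpose f; have [h1 h2] := phiP Z.
rewrite /loop !rw_comp !(lw_comp Y) -?compA.
rewrite (compRR (b_lw _ _ _)) (compRR (b_rw _ _ _)).
rewrite (compR (esym (lw_comp _ _ _))) h1 lw_comp -?compA.
rewrite !(compRR (esym (mid2N _ _))) -!(lw_comp Y).
by rewrite h2 (compRR (rw_lw _ _)).
Qed.

Lemma ftr_cyclic (f : Hom X' X) (g : Hom X X') Z :
  ftr e c (f \oc g) Z = ftr e' c' (g \oc f) Z.
Proof.
have [phi phiP] := evr_transpose f; have [h1 h2] := phiP Z.
by rewrite /ftr !rw_comp -?compA h2 (compRR h1) (compRR (rw_lw g _)).
Qed.

End Cyclicity.

End Braided.

(** * Scalar values of loops around simple objects *)

Section Scalars.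
Context {K : numClosedFieldType} {C : premodularCat K}.
Implicit Types X Y Z W A B D S : C.

Notation b X Y Z := (mid2 (braid X Y) Z).

Lemma abelC : abelian_cat C. Proof. exact: fus_abelian. Qed.

Definition scalar X (f : Hom X X) : K := coord [tuple idm X] ord0 f.

Lemma scalar_id X a : idm X != 0 -> scalar (a *: idm X) = a.
Proof.
move=> n; rewrite /scalar linearZ /=.
have := @coord_free _ _ _ [tuple idm X] ord0 ord0.
by rewrite /= => ->; rewrite ?mulr1// seq1_free.
Qed.

Lemma endo_scalar S (f : Hom S S) : simple S -> f = scalar f *: idm S.
Proof.
move=> sS; have [a e] := simple_endo abelC f sS.
by rewrite {1}e e scalar_id// simple_idm_neq0.
Qed.

Lemma loopE X D (e : Hom (D \ot X) unit_ob) (c : Hom unit_ob (X \ot D)) a Y Z :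
  loop e c a Y Z = lw Y (out2 (evr e) Z) \oc mid2 (braid X Y \oc braid Y X) (D \ot Z)
    \oc lw Y (in2 (rw a D \oc c) Z).
Proof. by rewrite mid2_comp mid2_in2 mid2_rw lw_comp -?compA. Qed.

Lemma loop_modfam X D (e : Hom (D \ot X) unit_ob) (c : Hom unit_ob (X \ot D)) a Y :
  modfam (fun Z => loop e c a Y Z).
Proof.
split=> [Z W g|Z W]; rewrite !loopE.
  rewrite -?compA -lw_comp -in2N lw_comp (compRR (mid2N _ _)).
  by rewrite (compR (esym (lw_comp Y _ _))) out2N lw_comp -?compA.
rewrite !rw_comp (compRR (assoc_lr _ _ _)) out2_mod !lw_comp -?compA.
have m2 V (r : Hom V _) :
    lw Y (assoc X (D \ot Z) W) \oc assoc Y (X \ot (D \ot Z)) W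
      \oc rw (mid2 (braid X Y \oc braid Y X) (D \ot Z)) W \oc r
    = mid2 (braid X Y \oc braid Y X) ((D \ot Z) \ot W)
      \oc lw Y (assoc X (D \ot Z) W) \oc assoc Y (X \ot (D \ot Z)) W \oc r.
  by have := congr1 (fun u => u \oc r)
    (mid2_mod (braid X Y \oc braid Y X) (D \ot Z) W); rewrite -?compA.
rewrite m2 (compRR (esym (mid2N _ _))) (assoc_lr Y).
have -> : lw Y (in2 (rw a D \oc c) (Z \ot W)) = lw Y (lw X (assoc D Z W))
    \oc lw Y (assoc X (D \ot Z) W) \oc lw Y (rw (in2 (rw a D \oc c) Z) W).
  by rewrite -!lw_comp in2_mod.
by rewrite -?compA.
Qed.

(** By [modfam_rw] the loop is the whiskering of an endomorphism of [S], a scalar by Schur's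
    lemma. *)
Lemma loop_scalar_ex X D (e : Hom (D \ot X) unit_ob) (c : Hom unit_ob (X \ot D)) a S :
  simple S -> exists al, forall Z, loop e c a S Z = al *: idm _.
Proof.
move=> sS; have := modfam_rw (loop_modfam e c a S) => m.
set f := (_ \oc _) in m; have [al ef] := simple_endo abelC f sS.
by exists al => Z; rewrite m ef rwZ rw_id.
Qed.

Definition fdualC X : fdual (ev X) (coev X) := fdualP (dualP X).

(* For Y simple, this is S_{Y,X} / qdim Y; see [qtrace_dbl]. *)
Definition hchar Y X : K := scalar (loop (ev X) (coev X) (idm X) Y unit_ob).

Lemma tens1_neq0 S : simple S -> idm (S \ot unit_ob) != 0.
Proof.
move=> /simple_idm_neq0; apply: contra => /eqP e.
by rewrite -(runitK S).2 -[runit' S]comp1m e comp0m compm0.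
Qed.

(** Cyclicity applied to [idm X \oc idm X] trades one choice of dual for another, so [hchar] can be
    computed with any dual. *)
Lemma loop_hchar S X D (e : Hom (D \ot X) unit_ob) (c : Hom unit_ob (X \ot D)) :
  simple S -> fdual e c -> forall Z, loop e c (idm X) S Z = hchar S X *: idm _.
Proof.
move=> sS d; have [al h] := loop_scalar_ex (ev X) (coev X) (idm X) sS.
have hE : hchar S X = al by rewrite /hchar h scalar_id// tens1_neq0.
move=> Z; rewrite hE -h -[idm X]comp1m.
exact: (loop_cyclic d (fdualC X)).
Qed.

Lemma hchar_tens S X X' : simple S -> hchar S (X \ot X') = hchar S X * hchar S X'.
Proof.
move=> sS; have d := prod_fdual (fdualC X) (fdualC X').
have := loop_hchar sS d unit_ob.
rewrite (@loop_prod_scalar _ _ _ _ _ _ _ _ _ _ _ _ (hchar S X) (hchar S X')); first last.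
- by move=> W; apply: loop_hchar => //; apply: fdualC.
- by move=> W; apply: loop_hchar => //; apply: fdualC.
by move/(congr1 (@scalar _)); rewrite !scalar_id// tens1_neq0.
Qed.

Lemma loopD X D (e : Hom (D \ot X) unit_ob) (c : Hom unit_ob (X \ot D)) Y Z a a' :
  loop e c (a + a') Y Z = loop e c a Y Z + loop e c a' Y Z.
Proof. by rewrite /loop rwD lwD compDl !compDr. Qed.

Lemma loop0 X D (e : Hom (D \ot X) unit_ob) (c : Hom unit_ob (X \ot D)) Y Z :
  loop e c 0 Y Z = 0.
Proof. by apply: (addrI (loop e c 0 Y Z)); rewrite -loopD !addr0. Qed.

(** The identity of [Z] is the sum of the [inj k \oc prj k], and cyclicity turns each of their loops
    into the loop of [idm (F k)]. *)
Lemma hchar_sum S n (F : 'I_n -> C) Z :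
  simple S -> direct_sum F Z -> hchar S Z = \sum_k hchar S (F k).
Proof.
move=> sS [inj [prj [h1 h2 h3]]].
have := loop_hchar sS (fdualC Z) unit_ob; rewrite -h3.
rewrite (big_morph (fun a => loop (ev Z) (coev Z) a S unit_ob)
  (loopD _ _ _ _) (loop0 _ _ _ _)).
under eq_bigr => k _.
  rewrite (loop_cyclic (fdualC Z) (fdualC (F k))) h1.
  rewrite loop_hchar//; last exact: fdualC.
  over.
rewrite -scaler_suml => /(congr1 (@scalar _)).
by rewrite !scalar_id// tens1_neq0.
Qed.

Lemma hchar_iso S X Y : simple S -> isomorphic X Y -> hchar S X = hchar S Y.
Proof.
by move=> sS /isomorphic_direct_sum d; rewrite (hchar_sum sS d) big_ord1.
Qed.

Lemma ftr_qtrace X (a : Hom X X) Z : ftr (ev X) (coev X) a Z = qtrace a *: idm Z.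
Proof.
rewrite /ftr -mid2_rw (compR (esym (out2_mid2 _ _ _))) out2_in2 -?compA.
have -> : ev X \oc braid X (dual X) \oc rw (twist X) (dual X)
    \oc rw a (dual X) \oc coev X = qtrace a *: idm _.
  rewrite [LHS]endo_scalar; last exact: fus_unit_simple.
  congr (_ *: _); rewrite /qtrace /unit_scalar /scalar; congr (coord _ _ _).
  by rewrite -/(rw _ _) rw_comp /evr -?compA.
by rewrite rwZ rw_id compZl comp1m compZr (lunitK _).2.
Qed.

Lemma unit_idm_neq0 : idm (unit_ob : C) != 0.
Proof. exact/simple_idm_neq0/fus_unit_simple. Qed.

Lemma ftr_qtrace_dual X D (e : Hom (D \ot X) unit_ob) (c : Hom unit_ob (X \ot D)) a Z :
  fdual e c -> ftr e c a Z = qtrace a *: idm Z.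
Proof.
by move=> d; rewrite -ftr_qtrace -[a]comp1m (ftr_cyclic d (fdualC X)) compm1 comp1m.
Qed.

Lemma qtrace_cyclic X Y (f : Hom X Y) (g : Hom Y X) : qtrace (f \oc g) = qtrace (g \oc f).
Proof.
have := ftr_cyclic (fdualC Y) (fdualC X) f g unit_ob.
rewrite !ftr_qtrace => /(congr1 (@scalar _)).
by rewrite !scalar_id// unit_idm_neq0.
Qed.

Lemma qtrace_dbl S X : simple S ->
  qtrace (braid X S \oc braid S X) = qdim S * hchar S X.
Proof.
move=> sS; have d := prod_fdual (fdualC S) (fdualC X).
have := ftr_qtrace_dual (braid X S \oc braid S X) unit_ob d.
rewrite (@ftr_prod_dbl _ _ _ _ _ _ _ _ _ _ _ (qdim S) (hchar S X)); first last.
- by move=> W; apply: loop_hchar => //; apply: fdualC.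
- by move=> W; rewrite ftr_qtrace.
by move/(congr1 (@scalar _)); rewrite !scalar_id// unit_idm_neq0.
Qed.

Lemma qdim_tens X Y : qdim (X \ot Y) = qdim X * qdim Y.
Proof.
have d := prod_fdual (fdualC X) (fdualC Y).
have := ftr_qtrace_dual (idm _) unit_ob d.
rewrite (@ftr_prod_id _ _ _ _ _ _ _ _ _ _ _ (qdim X) (qdim Y)); first last.
- by move=> W; rewrite ftr_qtrace.
- by move=> W; rewrite ftr_qtrace.
by move/(congr1 (@scalar _)); rewrite !scalar_id// unit_idm_neq0.
Qed.

Lemma ftrD X D (e : Hom (D \ot X) unit_ob) (c : Hom unit_ob (X \ot D)) Z a a' :
  ftr e c (a + a') Z = ftr e c a Z + ftr e c a' Z.
Proof. by rewrite /ftr rwD compDl !compDr. Qed.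

Lemma qtraceD X (a a' : Hom X X) : qtrace (a + a') = qtrace a + qtrace a'.
Proof.
have := ftrD (ev X) (coev X) unit_ob a a'.
rewrite !ftr_qtrace -scalerDl => /(congr1 (@scalar _)).
by rewrite !scalar_id// unit_idm_neq0.
Qed.

Lemma qtrace0 X : qtrace (0 : Hom X X) = 0.
Proof. by apply: (addrI (qtrace (0 : Hom X X))); rewrite -qtraceD !addr0. Qed.

Lemma qdim_sum n (F : 'I_n -> C) Z : direct_sum F Z -> qdim Z = \sum_k qdim (F k).
Proof.
move=> [inj [prj [h1 h2 h3]]].
rewrite /qdim -h3 (big_morph (@qtrace _ _ _) (@qtraceD _) (@qtrace0 _)).
by apply: eq_bigr => k _; rewrite qtrace_cyclic h1.
Qed.

Lemma qdim_iso X Y : isomorphic X Y -> qdim X = qdim Y.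
Proof. by move=> /isomorphic_direct_sum d; rewrite (qdim_sum d) big_ord1. Qed.

End Scalars.

(** * Characters of the Grothendieck ring *)

Section Grothendieck.
Context {K : numClosedFieldType} {C : modularCat K} {n : nat} (X : 'I_n.+1 -> C).
Hypotheses (hX : iso_class_reps simple X) (hX1 : X ord0 = unit_ob).
Implicit Types (A Y Z : C) (i j k : 'I_n.+1).

Local Notation mult := (multiplicity X).
Local Notation abel := (@abelC K C).

Definition chi i Y : K := hchar (X i) Y.

Lemma reps_simple i : simple (X i). Proof. by case: hX. Qed.
Hint Resolve reps_simple : core.

Lemma reps_iso i j : isomorphic (X i) (X j) -> i = j.
Proof. by case: hX => _ h _; apply: h. Qed.

Lemma reps_ex S : simple S -> exists i, isomorphic S (X i).
Proof. by case: hX => _ _; apply. Qed.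

Lemma mult_sum N (F : 'I_N -> C) Z k : (forall l, simple (F l)) -> direct_sum F Z ->
  mult k Z = #|[pred l | `[< isomorphic (F l) (X k) >]]|.
Proof. by move=> sF d; apply: (dim_hom_to_sum abel _ sF d). Qed.

Lemma dim_hom_reps_sym k Z : \dim {: Hom Z (X k)} = mult k Z.
Proof.
have [N [F [sF d]]] := fus_semisimple Z.
by rewrite (mult_sum k sF d) (dim_hom_from_sum abel _ sF d).
Qed.

Lemma mult_reps k i : mult k (X i) = (k == i) :> nat.
Proof.
have d := isomorphic_direct_sum (isomorphic_refl (X i)).
rewrite (mult_sum k (fun=> reps_simple i) d).
have [->|ki] := eqVneq k i.
  rewrite (@eq_card _ _ 'I_1) ?card_ord// => l.
  by apply/asboolP/isomorphic_refl.
by rewrite eq_card0// => l; apply/asboolP => /reps_iso e; rewrite e eqxx in ki.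
Qed.

Lemma mult_iso k Y Z : isomorphic Y Z -> mult k Y = mult k Z.
Proof.
move=> i; have [N [F [sF d]]] := fus_semisimple Y.
by rewrite (mult_sum k sF d) (mult_sum k sF (direct_sum_iso_l d i)).
Qed.

(** Every simple summand of [Y] has to be isomorphic to [X k], and the multiplicity 1 leaves a
    single summand. *)
Lemma mult_delta_iso k Y : (forall l, mult l Y = (l == k) :> nat) -> isomorphic Y (X k).
Proof.
move=> m; have [N [F [sF d]]] := fus_semisimple Y.
have [t tP] := boolp.choice (fun l => reps_ex (sF l)).
have tk l : t l = k.
  have : (0 < mult (t l) Y)%N.
    by rewrite (mult_sum _ sF d); apply/card_gt0P; exists l; apply/asboolP.
  by rewrite m; case: eqP.
have N1 : N = 1%N.
  rewrite -[LHS]card_ord; have := m k; rewrite (mult_sum k sF d) eqxx => e.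
  rewrite -[RHS]/(nat_of_bool true) -e.
  by apply: eq_card => l; rewrite !inE; apply/esym/asboolP; rewrite -(tk l).
subst N; apply: isomorphic_trans (isomorphic_sym (direct_sum1_iso d)) _.
by rewrite -(tk ord0).
Qed.

Lemma additive_mult (f : C -> K) Z :
  (forall N (F : 'I_N -> C) Y, direct_sum F Y -> f Y = \sum_l f (F l)) ->
  f Z = \sum_k (mult k Z)%:R * f (X k).
Proof.
move=> f_sum; have f_iso Y Y' : isomorphic Y Y' -> f Y = f Y'.
  by move=> /isomorphic_direct_sum d; rewrite (f_sum _ _ _ d) big_ord1.
have [N [F [sF d]]] := fus_semisimple Z; rewrite (f_sum _ _ _ d).
have [t tP] := boolp.choice (fun l => reps_ex (sF l)).
rewrite (partition_big t predT)//=; apply: eq_bigr => k _.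
rewrite (eq_bigr (fun=> f (X k))); last first.
  by move=> l /eqP <-; apply: f_iso.
rewrite sumr_const mulr_natl (mult_sum k sF d); congr (_ *+ _).
apply: eq_card => l; apply/idP/asboolP => [h|i].
  by have <- : t l = k by apply/eqP.
suff e : t l = k by rewrite -e; apply: eqxx.
exact/reps_iso/(isomorphic_trans (isomorphic_sym (tP l))).
Qed.

Lemma chi_mult i Z : chi i Z = \sum_k (mult k Z)%:R * chi i (X k).
Proof. by apply: additive_mult => N F Y d; apply: hchar_sum. Qed.

Lemma chi_iso i Y Z : isomorphic Y Z -> chi i Y = chi i Z.
Proof. exact: hchar_iso. Qed.

Lemma chiM i Y Z : chi i (Y \ot Z) = chi i Y * chi i Z.
Proof. exact: hchar_tens. Qed.

Lemma iso_unitl Y : isomorphic (unit_ob \ot Y) Y.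
Proof. by exists (lunit Y), (lunit' Y); apply: lunitK. Qed.

Lemma iso_unitr Y : isomorphic (Y \ot unit_ob) Y.
Proof. by exists (runit Y), (runit' Y); apply: runitK. Qed.

(** * The S-matrix and the separation of points by characters *)

Lemma SmatrixE i j : Smatrix X i j = qdim (X i) * chi i (X j).
Proof. by rewrite mxE qtrace_dbl. Qed.

Lemma Smatrix_sym i j : qdim (X i) * chi i (X j) = qdim (X j) * chi j (X i).
Proof. by rewrite -!SmatrixE !mxE qtrace_cyclic. Qed.

Definition chimx : 'M[K]_n.+1 := \matrix_(i, j) chi i (X j).

Lemma chimx_unit : chimx \in unitmx.
Proof.
have := S_nondegenerate hX.
have -> : Smatrix X = diag_mx (\row_i qdim (X i)) *m chimx.
  apply/matrixP => i j; rewrite SmatrixE mul_diag_mx !mxE.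
  by [].
by rewrite unitmx_mul => /andP[].
Qed.

Lemma qdim_neq0 i : qdim (X i) != 0.
Proof.
apply/eqP => q0; have := S_nondegenerate hX; rewrite unitmxE unitfE => /eqP[].
rewrite (expand_det_row _ i) big1// => j _.
by rewrite SmatrixE q0 !mul0r.
Qed.

(** The value at the unit is idempotent and fixes every value of [chi i]; were it 0, a row of the
    invertible [chimx] would vanish. *)
Lemma chi1 i : chi i unit_ob = 1.
Proof.
have h Y : chi i Y = chi i unit_ob * chi i Y.
  by rewrite -chiM (chi_iso _ (iso_unitl Y)).
have [e|] := eqVneq (chi i unit_ob) 0.
  have := chimx_unit; rewrite unitmxE unitfE (expand_det_row _ i) big1 ?eqxx// => j _.
  by rewrite mxE h e !mul0r.
by move=> n0; apply: (mulfI n0); rewrite -h mulr1.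
Qed.

Lemma chi_ord0 i : chi i (X ord0) = 1. Proof. by rewrite hX1 chi1. Qed.

Lemma qdim1 : qdim (unit_ob : C) = 1.
Proof.
have := qdim_neq0 ord0; rewrite hX1 => n0; apply: (mulfI n0).
by rewrite -qdim_tens mulr1; apply/qdim_iso/iso_unitl.
Qed.

(** Both sides are additive, and on simple objects they agree by the symmetry of the S-matrix in the
    row of the unit. *)
Lemma qdim_chi Y : qdim Y = chi ord0 Y.
Proof.
rewrite chi_mult (additive_mult _ (@qdim_sum _ _)).
apply: eq_bigr => k _; congr (_ * _).
by have := Smatrix_sym k ord0; rewrite hX1 chi1 qdim1 mulr1 mul1r.
Qed.

Lemma chi_sym i j : chi ord0 (X i) * chi i (X j) = chi ord0 (X j) * chi j (X i).
Proof. by rewrite -!qdim_chi Smatrix_sym. Qed.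

Lemma chi0_neq0 i : chi ord0 (X i) != 0.
Proof. by rewrite -qdim_chi qdim_neq0. Qed.

Lemma chi_inj i j : (forall k, chi i (X k) = chi j (X k)) -> i = j.
Proof.
move=> e; apply/eqP; apply: contraT => ij.
have := chimx_unit; rewrite unitmxE unitfE.
by rewrite (determinant_alternate ij) ?eqxx// => k; rewrite !mxE.
Qed.

Lemma chi_inj_reps i j : (forall k, chi k (X i) = chi k (X j)) -> i = j.
Proof.
move=> e; apply/eqP; apply: contraT => ij.
have := chimx_unit; rewrite -unitmx_tr unitmxE unitfE.
by rewrite (determinant_alternate ij) ?eqxx// => k; rewrite !mxE.
Qed.

Definition chiv i (v : 'rV[K]_n.+1) : K := \sum_k v 0 k * chi i (X k).

Lemma chivE i v : chiv i v = (v *m chimx^T) 0 i.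
Proof. by rewrite mxE; apply: eq_bigr => k _; rewrite !mxE. Qed.

(** The values [chiv i v] are the entries of [v *m chimx^T], and [chimx] is invertible. *)
Lemma chiv_inj u v : (forall i, chiv i u = chiv i v) -> u = v.
Proof.
move=> e; have un : chimx^T \in unitmx by rewrite unitmx_tr chimx_unit.
apply: (can_inj (mulmxK un)); apply/rowP => i.
by rewrite -!chivE.
Qed.

Lemma chivZ i a v : chiv i (a *: v) = a * chiv i v.
Proof. by rewrite mulr_sumr; apply: eq_bigr => k _; rewrite mxE mulrA. Qed.

Lemma chivD i u v : chiv i (u + v) = chiv i u + chiv i v.
Proof. by rewrite -big_split; apply: eq_bigr => k _; rewrite mxE mulrDl. Qed.

Lemma chiv0 i : chiv i 0 = 0.
Proof. by rewrite /chiv big1// => k _; rewrite mxE mul0r. Qed.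

Lemma chiv_sum i I (r : seq I) (P : pred I) (F : I -> 'rV[K]_n.+1) :
  chiv i (\sum_(a <- r | P a) F a) = \sum_(a <- r | P a) chiv i (F a).
Proof. exact: (big_morph _ (chivD i) (chiv0 i)). Qed.

Lemma chiv_Kclass i Y : chiv i (Kclass X K Y) = chi i Y.
Proof. by rewrite chi_mult; apply: eq_bigr => k _; rewrite mxE. Qed.

Lemma chiv_Kmul i u v : chiv i (Kmul X u v) = chiv i u * chiv i v.
Proof.
rewrite chiv_sum /chiv mulr_suml; apply: eq_bigr => k _.
rewrite -/(chiv _ _) chiv_sum mulr_sumr; apply: eq_bigr => l _.
by rewrite chivZ chiv_Kclass chiM mulrACA.
Qed.

Lemma chiv_Kone i : chiv i (Kone X K) = 1.
Proof. by rewrite chiv_Kclass chi1. Qed.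

(** Characters determine the class over [K], and in characteristic zero the class determines the
    multiplicities. *)
Lemma mult_chi Y Z k : (forall i, chi i Y = chi i Z) -> mult k Y = mult k Z.
Proof.
move=> e; have : Kclass X K Y = Kclass X K Z.
  by apply: chiv_inj => i; rewrite !chiv_Kclass.
by move=> /rowP /(_ k); rewrite !mxE => /eqP; rewrite eqr_nat => /eqP.
Qed.

(** * Duality and orthogonality of characters *)

Lemma dim_hom_dual A Y Z :
  \dim {: Hom (dual A \ot Y) Z} = \dim {: Hom Y (A \ot Z)}.
Proof.
have d := fdualC A.
pose F (f : Hom (dual A \ot Y) Z) := lw A f \oc in2 (coev A) Y.
pose G (g : Hom Y (A \ot Z)) := out2 (ev A) Z \oc lw (dual A) g.
have FK : cancel F G.
  move=> f; rewrite /F /G lw_comp (compR (out2N _ _)) -?compA (fzag d).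
  exact: compm1.
have GK : cancel G F.
  by move=> g; rewrite /F /G lw_comp -?compA in2N (compR (fzig d _)) comp1m.
apply/eqP; rewrite eqn_leq; apply/andP; split.
  by apply: (dim_bij_le _ FK) => a u v; rewrite /F lwD lwZ compDl compZl.
by apply: (dim_bij_le _ GK) => a u v; rewrite /G lwD lwZ compDr compZr.
Qed.

Lemma mult_dual A j k : mult k (dual A \ot X j) = mult j (A \ot X k).
Proof. by rewrite -dim_hom_reps_sym dim_hom_dual. Qed.

Lemma mult_dual0 A k : mult k (dual A) = mult ord0 (A \ot X k).
Proof. by rewrite -mult_dual hX1; apply/esym/mult_iso/iso_unitr. Qed.

Lemma chi_mul_mult i A j :
  chi i A * chi i (X j) = \sum_k (mult k (A \ot X j))%:R * chi i (X k).
Proof. by rewrite -chiM chi_mult. Qed.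

Definition gram i j : K := \sum_k chi i (X k) * (chi j (X k))^*.

Lemma gram_gt0 i : 0 < gram i i.
Proof.
rewrite /gram (bigD1 ord0)//= chi_ord0 rmorph1 mulr1 ltr_wpDr//.
by apply: sumr_ge0 => k _; apply: mul_conjC_ge0.
Qed.

(** Multiplication by [A] is an integer matrix whose transpose is multiplication by [dual A], by
    [mult_dual], so it moves across the Hermitian pairing. *)
Lemma gram_dual i j A : chi i A * gram i j = (chi j (dual A))^* * gram i j.
Proof.
rewrite {1}/gram mulr_sumr.
under eq_bigr => k _ do rewrite mulrA chi_mul_mult mulr_suml.
rewrite exchange_big /= /gram mulr_sumr; apply: eq_bigr => k _.
rewrite mulrCA -rmorphM chi_mul_mult rmorph_sum mulr_sumr; apply: eq_bigr => l _ /=.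
by rewrite rmorphM rmorph_nat mult_dual mulrCA mulrA.
Qed.

Lemma chi_dual i A : chi i (dual A) = (chi i A)^*.
Proof.
have := gram_dual i i A; rewrite mulrC [RHS]mulrC => /mulfI -> //.
  by rewrite conjCK.
by rewrite gt_eqF// gram_gt0.
Qed.

(** By [gram_dual] and [chi_dual], a nonzero pairing would make the two characters agree
    everywhere. *)
Lemma gram_orth i j : i != j -> gram i j = 0.
Proof.
move=> ij; apply/eqP; apply: contraNT ij => g0.
apply/eqP/chi_inj => k; apply: (mulIf g0).
by rewrite gram_dual chi_dual conjCK.
Qed.

(** Characters do not see the order of the factors; in the other order the multiplicity is the
    dimension of the endomorphisms of [X i]. *)
Lemma mult0_dual_reps i : mult ord0 (X i \ot dual (X i)) = 1%N.
Proof.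
rewrite (@mult_chi _ (dual (X i) \ot X i)) => [|l]; last by rewrite !chiM mulrC.
by rewrite mult_dual hX1 (mult_iso _ (iso_unitr _)) mult_reps eqxx.
Qed.

Lemma mult_mul Y Z k : mult k (Y \ot Z) = (\sum_l mult l Z * mult k (Y \ot X l))%N.
Proof.
have : Kclass X K (Y \ot Z) = \sum_l (mult l Z)%:R *: Kclass X K (Y \ot X l).
  apply: chiv_inj => i; rewrite chiv_Kclass chiv_sum chiM (chi_mult i Z) mulr_sumr.
  by apply: eq_bigr => l _; rewrite chivZ chiv_Kclass chiM mulrCA.
move/rowP/(_ k); rewrite summxE mxE.
rewrite (eq_bigr (fun l => (mult l Z * mult k (Y \ot X l))%:R)) => [|l _].
  by rewrite -natr_sum => /eqP; rewrite eqr_nat => /eqP.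
by rewrite !mxE natrM.
Qed.

(* The unit has multiplicity 1 in X_i (x) X_i^*, which says that the squares of
   the multiplicities in X_i^* add up to 1. *)
Lemma dual_reps i : exists k, isomorphic (dual (X i)) (X k).
Proof.
have := mult0_dual_reps i; rewrite mult_mul.
under eq_bigr do rewrite -mult_dual0.
move=> s1; have [k k0] : exists k, (mult k (dual (X i)) != 0)%N.
  apply/existsP; apply: contraT; rewrite negb_exists => /forallP h.
  move: s1; rewrite big1// => l _; by have := h l; rewrite negbK => /eqP ->.
exists k; apply: mult_delta_iso => l.
move: s1; rewrite (bigD1 k)//=.
have [->|lk] := eqVneq l k.
  by move: k0; case: (mult k _) => [|[|a]].
rewrite (bigD1 l)//=; move: k0.
by case: (mult k _) => [|[|a]]//=; case: (mult l _) => [|b].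
Qed.

(** Duality permutes the simple classes, so sums and products can be reindexed along it; injectivity
    comes from that of conjugation. *)
Lemma dual_index : exists2 s : 'I_n.+1 -> 'I_n.+1, injective s &
  forall i j, chi j (X (s i)) = (chi j (X i))^*.
Proof.
have [s sP] := boolp.choice dual_reps.
have sE i j : chi j (X (s i)) = (chi j (X i))^*.
  by rewrite -(chi_iso _ (sP i)) chi_dual.
exists s => // i j e; apply: chi_inj_reps => k.
by apply: (can_inj (@conjCK K)); rewrite -!sE e.
Qed.

(** * A character with positive values *)

Lemma real_max (f : 'I_n.+1 -> K) : (forall i, f i \is Num.real) ->
  exists i, forall j, f j <= f i.
Proof.
move=> fr.
have h (s : seq 'I_n.+1) : exists i, forall j, j \in s -> f j <= f i.
  elim: s => [|a s [i ih]]; first by exists ord0.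
  have /orP[ai|ia] := real_leVge (fr a) (fr i).
    by exists i => j; rewrite inE => /predU1P[->|/ih].
  exists a => j; rewrite inE => /predU1P[->//|/ih h].
  exact: le_trans h ia.
have [i ih] := h (enum 'I_n.+1).
by exists i => j; rewrite ih// mem_enum.
Qed.

(** The quadratic form of an operator acting on [chi j] by [a j], at the vector with coordinates
    [c]; orthogonality removes the mixed terms. *)
Lemma gram_expansion (c a : 'I_n.+1 -> K) :
  \sum_k (\sum_i c i * chi i (X k))^* * (\sum_j c j * a j * chi j (X k))
  = \sum_j a j * (`|c j| ^+ 2 * gram j j).
Proof.
transitivity (\sum_j \sum_i a j * (c j * (c i)^* * gram j i)).
  under eq_bigr => k _ do rewrite mulr_sumr.
  rewrite exchange_big /=; apply: eq_bigr => j _.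
  under eq_bigr => k _ do rewrite rmorph_sum mulr_suml.
  rewrite exchange_big /=; apply: eq_bigr => i _.
  rewrite /gram !mulr_sumr; apply: eq_bigr => k _.
  by rewrite rmorphM; ring.
apply: eq_bigr => j _; rewrite (bigD1 j)//= big1 ?addr0 ?normCK// => i ij.
by rewrite gram_orth ?mulr0// eq_sym.
Qed.

Lemma chi_expansion (w : 'I_n.+1 -> K) :
  exists c, forall k, w k = \sum_j c j * chi j (X k).
Proof.
exists (fun j => ((\row_k w k) *m invmx chimx) 0 j) => k.
transitivity ((\row_k w k *m invmx chimx *m chimx) 0 k).
  by rewrite mulmxKV ?chimx_unit// mxE.
by rewrite mxE; apply: eq_bigr => j _; rewrite [chimx _ _]mxE.
Qed.

(* The sum of the classes of all simple objects acts by a nonnegative symmetric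
   matrix; the character with the largest value on it is nonnegative, as taking
   absolute values of its eigenvector can only increase the Rayleigh quotient. *)
Lemma positive_character : exists j0, forall k, 0 < chi j0 (X k).
Proof.
pose tot j := \sum_l chi j (X l).
have tot_real j : tot j \is Num.real.
  have [s s_inj sE] := dual_index.
  rewrite CrealE rmorph_sum [X in _ == X](reindex_inj s_inj) /=.
  by apply/eqP; apply: eq_bigr => l _; rewrite sE.
have [j0 j0P] := real_max tot_real; exists j0.
pose M k m : nat := (\sum_l mult m (X l \ot X k))%N.
have Mchi j k : \sum_m (M k m)%:R * chi j (X m) = tot j * chi j (X k).
  rewrite mulr_suml; under [RHS]eq_bigr do rewrite chi_mul_mult.
  rewrite exchange_big /=; apply: eq_bigr => m _.
  by rewrite natr_sum mulr_suml.
have Mexp w c : (forall k, w k = \sum_j c j * chi j (X k)) ->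
    forall k, \sum_m (M k m)%:R * w m = \sum_j c j * tot j * chi j (X k).
  move=> e k; under eq_bigr do rewrite e mulr_sumr.
  rewrite exchange_big /=; apply: eq_bigr => j _.
  rewrite -mulrA -Mchi mulr_sumr; apply: eq_bigr => m _; ring.
pose v k := chi j0 (X k).
(* In the orthogonal eigenbasis of characters, the form at the vector of absolute values is bounded
   by the largest eigenvalue [tot j0]. *)
have le_quad : \sum_k `|v k| * (\sum_m (M k m)%:R * `|v m|)
    <= tot j0 * \sum_k `|v k| ^+ 2.
  have [c cE] := chi_expansion (fun k => `|v k|).
  have e1 : \sum_k `|v k| * (\sum_m (M k m)%:R * `|v m|)
      = \sum_j tot j * (`|c j| ^+ 2 * gram j j).
    rewrite -gram_expansion; apply: eq_bigr => k _.
    by rewrite (Mexp (fun k => `|v k|) c)// -cE conj_normC.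
  have e2 : \sum_k `|v k| ^+ 2 = \sum_j 1 * (`|c j| ^+ 2 * gram j j).
    rewrite -(gram_expansion c (fun=> 1)); apply: eq_bigr => k _.
    rewrite [X in _ = _ * X](eq_bigr (fun j => c j * chi j (X k))) => [|j _]; last first.
      by rewrite mulr1.
    by rewrite -cE conj_normC expr2.
  rewrite e1 e2 mulr_sumr; apply: ler_sum => j _; rewrite mul1r.
  apply: ler_wpM2r => //; apply: mulr_ge0; first by rewrite exprn_ge0.
  exact/ltW/gram_gt0.
(* The eigenvector [v] attains this bound, and the value is real. *)
have eq_quad : \sum_k \sum_m (M k m)%:R * 'Re ((v k)^* * v m)
    = tot j0 * \sum_k `|v k| ^+ 2.
  have : 'Re (tot j0 * \sum_k `|v k| ^+ 2) = tot j0 * \sum_k `|v k| ^+ 2.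
    apply/Creal_ReP; rewrite rpredM// rpred_sum// => k _.
    by rewrite rpredX// normr_real.
  move=> <-; rewrite mulr_sumr raddf_sum; apply: eq_bigr => k _ /=.
  rewrite normCK mulrA -Mchi mulr_suml raddf_sum; apply: eq_bigr => m _ /=.
  by rewrite -mulrA [_ * _^*]mulrC !mulr_natl raddfMn.
(* The termwise difference of the two forms: each term is nonnegative and their sum is at most 0, so
   all vanish. *)
pose T k m := (M k m)%:R * (`|v k| * `|v m| - 'Re ((v k)^* * v m)).
have T_ge0 k m : 0 <= T k m.
  rewrite mulr_ge0// subr_ge0 -(norm_conjC (v k)) -normrM.
  by rewrite (leif_Re_Creal _).1.
have sumT : \sum_k \sum_m T k m <= 0.
  have -> : \sum_k \sum_m T k m = \sum_k `|v k| * (\sum_m (M k m)%:R * `|v m|)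
      - \sum_k \sum_m (M k m)%:R * 'Re ((v k)^* * v m).
    rewrite -sumrB; apply: eq_bigr => k _; rewrite mulr_sumr -sumrB.
    by apply: eq_bigr => m _; rewrite /T mulrBr mulrCA.
  by rewrite eq_quad subr_le0.
have T0 m : T ord0 m = 0.
  apply/le_anti/andP; split; last exact: T_ge0.
  apply: le_trans sumT; rewrite (bigD1 ord0)//= (bigD1 m)//= -addrA lerDl.
  by rewrite addr_ge0// sumr_ge0// => k _; rewrite ?sumr_ge0.
(* In the row of the unit, [v ord0] is 1 and every simple object occurs, so [T0] says that [v m] has
   absolute value equal to its real part. *)
have v_ge0 m : 0 <= v m.
  have M0 : (M ord0 m)%:R != 0 :> K.
    rewrite pnatr_eq0 /M (bigD1 m)//=.
    by rewrite hX1 (mult_iso _ (iso_unitr _)) mult_reps eqxx.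
  have /eqP := T0 m; rewrite /T mulf_eq0 (negPf M0) /v chi_ord0 normr1 rmorph1 !mul1r.
  by rewrite subr_eq0 eq_sym (leif_Re_Creal _).2.
(* A zero at [X k] would be a zero at [X k \ot dual (X k)], which contains the unit. *)
move=> k; rewrite lt_neqAle v_ge0 andbT eq_sym; apply/eqP => v0.
have : 0 < chi j0 (X k \ot dual (X k)).
  rewrite chi_mult (bigD1 ord0)//= mult0_dual_reps chi_ord0 mulr1 ltr_wpDr//.
  by rewrite sumr_ge0// => l _; rewrite mulr_ge0// v_ge0.
by rewrite chiM v0 mul0r ltxx.
Qed.

(** * Grouplike elements and ring morphisms to the base field *)

Lemma Kclass_reps (A : pzRingType) i : Kclass X A (X i) = delta_mx 0 i.
Proof. by apply/rowP => k; rewrite !mxE mult_reps eqxx. Qed.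

Lemma map_Kclass Y : map_mx intr (Kclass X int Y) = Kclass X K Y.
Proof. by apply/rowP => k; rewrite !mxE rmorph_nat. Qed.

Lemma map_Kmul (u v : 'rV[int]_n.+1) :
  map_mx intr (Kmul X u v) = Kmul X (map_mx intr u) (map_mx intr v) :> 'rV[K]_n.+1.
Proof.
rewrite /Kmul raddf_sum; apply: eq_bigr => i _.
rewrite raddf_sum; apply: eq_bigr => j _ /=.
by rewrite map_mxZ rmorphM map_Kclass !mxE.
Qed.

(** The squared modulus of [chi j (X i)] is the value of [chi j] on the product of [X i] and its
    dual; characters separate points, and the integers embed in [K]. *)
Lemma grouplike_chi i : grouplike X i <-> forall j, `|chi j (X i)| = 1.
Proof.
have e j : chi j (X i) * chi j (dual (X i)) = `|chi j (X i)| ^+ 2.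
  by rewrite normCK chi_dual.
split=> [g j|h].
  have := congr1 (map_mx intr : _ -> 'rV[K]_n.+1) g.
  rewrite map_Kmul !map_Kclass => /(congr1 (chiv j)).
  rewrite chiv_Kmul !chiv_Kclass chi1 e => /eqP.
  by rewrite sqrf_eq1 => /orP[/eqP//|/eqP h]; have := normr_ge0 (chi j (X i));
    rewrite h oppr_ge0 ler10.
have : map_mx intr (Kmul X (Kclass X int (X i)) (Kclass X int (dual (X i))))
    = map_mx intr (Kone X int) :> 'rV[K]_n.+1.
  rewrite map_Kmul !map_Kclass; apply: chiv_inj => j.
  by rewrite chiv_Kmul !chiv_Kclass chi1 e h expr1n.
move=> eK; apply/rowP => k.
by move/rowP/(_ k): eK; rewrite [LHS]mxE [RHS]mxE => /intr_inj.
Qed.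

Lemma Kmul_reps (A : pzRingType) i j :
  Kmul X (Kclass X A (X i)) (Kclass X A (X j)) = Kclass X A (X i \ot X j).
Proof.
rewrite /Kmul !Kclass_reps (bigD1 i)//= [X in _ + X]big1 => [|k ki]; last first.
  by rewrite big1// => l _; rewrite !mxE (negPf ki) andbF mul0r scale0r.
rewrite addr0 (bigD1 j)//= big1 => [|k kj]; last first.
  by rewrite !mxE (negPf kj) andbF mulr0 scale0r.
by rewrite addr0 !mxE !eqxx mulr1 scale1r.
Qed.

(* On a nonzero vector [e] with [v e = chi_j(v) e], a multiplicative functional
   not killing [e] must be [chi_j]. *)
Lemma ring_morphism_chi (mu : 'rV[int]_n.+1 -> K) : Kring_morphism X mu ->
  exists j, forall i, mu (Kclass X int (X i)) = chi j (X i).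
Proof.
case=> mu1 muD muM.
have mu0 : mu 0 = 0 by apply: (addrI (mu 0)); rewrite -muD !addr0.
have muMn u a : mu (u *+ a) = mu u *+ a.
  by elim: a => [|a ih]; rewrite ?mulr0n// !mulrSr muD ih.
have mu_sum I (r : seq I) (P : pred I) (F : I -> 'rV[int]_n.+1) :
    mu (\sum_(a <- r | P a) F a) = \sum_(a <- r | P a) mu (F a).
  exact: (big_morph _ muD mu0).
pose m k := mu (Kclass X int (X k)).
(* [M] is the [K]-linear extension of [mu]. *)
pose M (v : 'rV[K]_n.+1) := \sum_k v 0 k * m k.
have MZ a v : M (a *: v) = a * M v.
  by rewrite /M mulr_sumr; apply: eq_bigr => k _; rewrite mxE mulrA.
have MD u v : M (u + v) = M u + M v.
  by rewrite /M -big_split; apply: eq_bigr => k _; rewrite mxE mulrDl.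
have M0 : M 0 = 0 by apply: (addrI (M 0)); rewrite -MD !addr0.
have M_sum I (r : seq I) (P : pred I) (F : I -> 'rV[K]_n.+1) :
    M (\sum_(a <- r | P a) F a) = \sum_(a <- r | P a) M (F a).
  exact: (big_morph _ MD M0).
have MK Y : M (Kclass X K Y) = mu (Kclass X int Y).
  have -> : Kclass X int Y = \sum_k Kclass X int (X k) *+ mult k Y.
    apply/rowP => l; rewrite summxE (bigD1 l)//= big1 => [|k kl].
      by rewrite addr0 Kclass_reps mulmxnE !mxE !eqxx.
    by rewrite Kclass_reps mulmxnE !mxE eq_sym (negPf kl) andbF mul0rn.
  rewrite mu_sum; apply: eq_bigr => k _.
  by rewrite mxE muMn mulr_natl.
have MM u v : M (Kmul X u v) = M u * M v.
  rewrite M_sum [M u]/M mulr_suml; apply: eq_bigr => i _.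
  rewrite M_sum [M v]/M mulr_sumr; apply: eq_bigr => j _.
  by rewrite MZ MK mulrACA /m -muM Kmul_reps.
(* The idempotents dual to the characters. They sum to 1, so [M] is nonzero on one of them. *)
pose e j : 'rV[K]_n.+1 := row j (invmx chimx^T).
have chie i j : chiv i (e j) = (i == j)%:R.
  rewrite chivE /e -row_mul mulVmx ?unitmx_tr ?chimx_unit//.
  by rewrite !mxE eq_sym.
have sume : \sum_j e j = Kone X K.
  apply: chiv_inj => i; rewrite chiv_sum chiv_Kone (bigD1 i)//= chie eqxx.
  by rewrite big1 ?addr0// => j ji; rewrite chie eq_sym (negPf ji).
have [j Mj] : exists j, M (e j) != 0.
  apply/existsP; apply: contraT; rewrite negb_exists => /forallP h.
  have : M (Kone X K) = 1 by rewrite MK.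
  rewrite -sume M_sum big1 => [/eqP|k _]; first by rewrite eq_sym oner_eq0.
  by apply/eqP; have := h k; rewrite negbK.
exists j => i; apply: (mulIf Mj); rewrite -MK -MM -MZ; congr M.
apply: chiv_inj => k; rewrite chiv_Kmul chivZ chie chiv_Kclass.
by have [->|_] := eqVneq k j; rewrite ?mulr0.
Qed.

(** * Consequences of the positivity of a character *)

Section PositiveCharacter.
Variable j0 : 'I_n.+1.
Hypothesis chi_gt0 : forall k, 0 < chi j0 (X k).

Lemma pchi_ge0 Y : 0 <= chi j0 Y.
Proof.
by rewrite chi_mult sumr_ge0// => k _; rewrite mulr_ge0// ltW.
Qed.

Lemma pchi_dual Y : chi j0 (dual Y) = chi j0 Y.
Proof. by rewrite chi_dual geC0_conj// pchi_ge0. Qed.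

(** The square of the value is the value at [X k \ot dual (X k)], where the unit contributes 1 and
    the rest is nonnegative. *)
Lemma pchi_ge1 k : 1 <= chi j0 (X k).
Proof.
have d0 := ltW (chi_gt0 k); rewrite -(@ler_pXn2r _ 2)// ?nnegrE ?ler01// expr1n.
have := chiM j0 (X k) (dual (X k)); rewrite pchi_dual -expr2 => <-.
rewrite chi_mult (bigD1 ord0)//= mult0_dual_reps chi_ord0 mulr1 lerDl.
by rewrite sumr_ge0// => l _; rewrite mulr_ge0// ltW.
Qed.

(* Pair |chi_i(Y)| |v| <= N_Y |v|, for the eigenvector v = (chi_i(X_k))_k of the
   multiplication matrix N_Y, with the positive eigenvector of chi_j0. *)
Lemma norm_chi_le i Y : `|chi i Y| <= chi j0 Y.
Proof.
pose s := \sum_k chi j0 (X k) * `|chi i (X k)|.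
have s_gt0 : 0 < s.
  rewrite /s (bigD1 ord0)//= !chi_ord0 normr1 mulr1 ltr_wpDr//.
  by rewrite sumr_ge0// => k _; rewrite mulr_ge0// ltW.
rewrite -(ler_pM2r s_gt0) /s !mulr_sumr.
have -> : \sum_k chi j0 Y * (chi j0 (X k) * `|chi i (X k)|)
   = \sum_k chi j0 (X k) * \sum_l (mult l (Y \ot X k))%:R * `|chi i (X l)|.
  under [RHS]eq_bigr => k _ do rewrite mulr_sumr.
  rewrite exchange_big /=; apply: eq_bigr => l _.
  rewrite mulrA -(pchi_dual Y) chi_mul_mult mulr_suml; apply: eq_bigr => k _.
  by rewrite mult_dual; ring.
apply: ler_sum => k _; rewrite mulrCA; apply: ler_wpM2l; first exact: ltW.
rewrite -normrM chi_mul_mult.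
apply: le_trans (ler_norm_sum _ _ _) _; apply: ler_sum => l _.
by rewrite normrM normr_nat.
Qed.

Lemma sum_mult_le1 Y : chi j0 Y <= 1 -> (\sum_k mult k Y <= 1)%N.
Proof.
move=> Y1; rewrite -(ler_nat K); apply: le_trans Y1.
rewrite chi_mult natr_sum; apply: ler_sum => k _.
by rewrite ler_peMr// pchi_ge1.
Qed.

(** Each simple constituent contributes at least 1, so a total of 1 leaves room for exactly one. *)
Lemma pchi1_reps Y : chi j0 Y = 1 -> exists k, isomorphic Y (X k).
Proof.
move=> Y1; have s1 : (\sum_k mult k Y <= 1)%N by rewrite sum_mult_le1// Y1.
have [k k0] : exists k, mult k Y != 0%N.
  apply/existsP; apply: contraT; rewrite negb_exists => /forallP h.
  move: Y1; rewrite chi_mult big1 => [/eqP|l _]; first by rewrite eq_sym oner_eq0.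
  by have := h l; rewrite negbK => /eqP ->; rewrite mul0r.
exists k; apply: mult_delta_iso => l.
move: s1; rewrite (bigD1 k)//=.
have [->|lk] := eqVneq l k.
  by move: k0; case: (mult k _) => [|[|a]].
rewrite (bigD1 l)//=; move: k0.
by case: (mult k _) => [|[|a]]//=; case: (mult l _) => [|b].
Qed.

(** [Y] is some simple [X i], and [X i \ot dual (X i)] is simple for the same reason; it contains
    the unit, so it is the unit. *)
Lemma norm_chi_pchi1 Y j : chi j0 Y = 1 -> `|chi j Y| = 1.
Proof.
move=> Y1; have [i Yi] := pchi1_reps Y1; rewrite (chi_iso _ Yi).
have d1 : chi j0 (X i \ot dual (X i)) = 1.
  by rewrite chiM pchi_dual -(chi_iso _ Yi) Y1 mulr1.
have [k ik] := pchi1_reps d1; have := mult0_dual_reps i.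
rewrite (mult_iso _ ik) mult_reps; case: eqP => // k0 _.
have := chi_iso j ik; rewrite -k0 chi_ord0 chiM chi_dual -normCK => /eqP.
by rewrite sqrf_eq1 => /orP[/eqP//|/eqP h]; have := normr_ge0 (chi j (X i));
    rewrite h oppr_ge0 ler10.
Qed.

Lemma pchi_grouplike i : grouplike X i -> chi j0 (X i) = 1.
Proof. by move=> /grouplike_chi/(_ j0); rewrite ger0_norm// pchi_ge0. Qed.

Lemma grouplike_pchi i : chi j0 (X i) = 1 -> grouplike X i.
Proof. by move=> h; apply/grouplike_chi => j; apply: norm_chi_pchi1. Qed.

(** * The group of invertible objects *)

Lemma grouplike_tens i j : grouplike X i -> grouplike X j ->
  exists2 k, grouplike X k & isomorphic (X i \ot X j) (X k).
Proof.
move=> gi gj; have d1 : chi j0 (X i \ot X j) = 1.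
  by rewrite chiM !pchi_grouplike// mulr1.
have [k ik] := pchi1_reps d1; exists k => //.
by apply: grouplike_pchi; rewrite -(chi_iso _ ik).
Qed.

Definition grouplikes : {set 'I_n.+1} := [set i | `[< grouplike X i >]].

Lemma grouplikesP i : reflect (grouplike X i) (i \in grouplikes).
Proof. by rewrite inE; apply: asboolP. Qed.

Lemma grouplike_neq0 i j : grouplike X j -> chi i (X j) != 0.
Proof. by move=> /grouplike_chi/(_ i) e; rewrite -normr_eq0 e oner_eq0. Qed.

(** Lagrange's theorem: multiplication by [X j] permutes the grouplikes, so it leaves the product of
    the values of [chi i] over them unchanged. *)
Lemma grouplike_expn i j : grouplike X j -> chi i (X j) ^+ #|grouplikes| = 1.
Proof.
move=> gj.
(* Off the grouplikes, [k] itself is a placeholder value. *)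
have /boolp.choice [s sP] k : exists l, k \in grouplikes ->
    l \in grouplikes /\ isomorphic (X j \ot X k) (X l).
  case: (boolP (k \in grouplikes)) => [/grouplikesP gk|_]; last by exists k.
  by have [l /grouplikesP gl il] := grouplike_tens gj gk; exists l.
have s_inj : {in grouplikes &, injective s}.
  move=> k l /sP[_ ik] /sP[_ il] e; apply: chi_inj_reps => a.
  apply: (mulfI (grouplike_neq0 a gj)).
  by rewrite -!chiM (chi_iso _ ik) (chi_iso _ il) e.
have s_im : s @: grouplikes = grouplikes.
  apply/eqP; rewrite eqEcard card_in_imset// leqnn andbT.
  by apply/subsetP => k /imsetP[l /sP[gl _] ->].
have p0 : \prod_(k in grouplikes) chi i (X k) != 0.
  by apply/prodf_neq0 => k /grouplikesP; apply: grouplike_neq0.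
apply: (mulIf p0); rewrite mul1r -[in RHS]s_im big_imset//=.
rewrite -prodr_const -big_split /=; apply: eq_bigr => k /sP[_ ik].
by rewrite -chiM (chi_iso _ ik).
Qed.

Lemma Kclass1_iso Y : (forall j, chi j Y = 1) -> isomorphic Y unit_ob.
Proof.
move=> h; rewrite -hX1; apply: mult_delta_iso => l.
by rewrite (@mult_chi _ (X ord0)) ?mult_reps// => j; rewrite h chi_ord0.
Qed.

(** Nonzero values of [chi j0] are at least 1, and two of them with product 1 are both 1. *)
Lemma pchi_invertible Y : invertible Y -> chi j0 Y = 1.
Proof.
case=> Z [YZ _]; have := chi_iso j0 YZ; rewrite chiM chi1.
have ge1 W : chi j0 W != 0 -> 1 <= chi j0 W.
  rewrite chi_mult => s0; have [k k0] : exists k, mult k W != 0%N.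
    apply/existsP; apply: contraNT s0; rewrite negb_exists => /forallP h.
    by rewrite big1// => l _; have := h l; rewrite negbK => /eqP ->; rewrite mul0r.
  rewrite (bigD1 k)//= ler_wpDr//.
    by rewrite sumr_ge0// => l _; rewrite mulr_ge0// ltW.
  by rewrite mulr_ege1 ?pchi_ge1// ler1n lt0n.
move=> e; have : chi j0 Y * chi j0 Z != 0 by rewrite e oner_eq0.
rewrite mulf_eq0 negb_or => /andP[/ge1 Y1 /ge1 Z1]; apply/le_anti; rewrite Y1 andbT.
by rewrite -e ler_peMr// pchi_ge0.
Qed.

(** Invertible objects have value 1 under [chi j0], hence are simple and grouplike. Conversely all
    characters are 1 on the product of a grouplike with its dual, which is therefore the unit. *)
Lemma card_grouplikes g (G : 'I_g -> C) : iso_class_reps invertible G ->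
  #|grouplikes| = g.
Proof.
case=> Ginv Ginj Gsurj.
have [t tP] := boolp.choice (fun a => pchi1_reps (pchi_invertible (Ginv a))).
have t_inj : injective t.
  move=> a b e; apply: Ginj; apply: isomorphic_trans (tP a) _.
  by rewrite e; apply: isomorphic_sym.
rewrite -[RHS]card_ord -(card_codom t_inj); apply: eq_card => k.
apply/grouplikesP/codomP => [gk|[a ->]]; last first.
  by apply: grouplike_pchi; rewrite -(chi_iso _ (tP a)) pchi_invertible.
have [a ka] : exists a, isomorphic (X k) (G a).
  apply: Gsurj; exists (dual (X k)).
  have e j : chi j (X k) * (chi j (X k))^* = 1.
    by rewrite -normCK; move/grouplike_chi: gk => ->; rewrite expr1n.
  by split; apply: Kclass1_iso => j; rewrite chiM chi_dual // mulrC.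
by exists a; apply/reps_iso/(isomorphic_trans ka).
Qed.

(** * The adjoint subcategory and its regular element *)

Lemma adjoint_iso Y Z : isomorphic Y Z -> in_adjoint Y -> in_adjoint Z.
Proof.
move=> /isomorphic_direct_sum d aY P fP h.
by apply: (fsub_sum fP _ d) => _; apply: aY.
Qed.

Lemma adjoint_mult Y k : in_adjoint Y -> mult k Y != 0%N -> in_adjoint (X k).
Proof.
have [N [F [sF d]]] := fus_semisimple Y.
rewrite (mult_sum k sF d) -lt0n => aY /card_gt0P[l /asboolP Fl].
by apply: adjoint_iso Fl _ => P fP h; apply: (fsub_summand fP _ d); apply: aY.
Qed.

Lemma adjoint_tens Y Z : in_adjoint Y -> in_adjoint Z -> in_adjoint (Y \ot Z).
Proof. by move=> aY aZ P fP h; apply: (fsub_tens fP); [apply: aY|apply: aZ]. Qed.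

Lemma adjoint_dual Y : in_adjoint Y -> in_adjoint (dual Y).
Proof. by move=> aY P fP h; apply: (fsub_dual fP); apply: aY. Qed.

Lemma adjoint_tens_dual i : in_adjoint (X i \ot dual (X i)).
Proof. by move=> P fP; apply. Qed.

Local Notation ad := (fun i => `[< in_adjoint (X i) >]).

(** The sum is [chi j] of the regular element. Products with [X k] and its dual stay in the adjoint
    subcategory, so both sums restrict to it, and duality transposes the multiplicities. *)
Lemma regular_eigen j k : in_adjoint (X k) ->
  chi j (X k) * (\sum_(i | ad i) chi j0 (X i) * chi j (X i))
  = chi j0 (X k) * (\sum_(i | ad i) chi j0 (X i) * chi j (X i)).
Proof.
move=> ak; rewrite !mulr_sumr.
transitivity (\sum_(i | ad i) \sum_(l | ad l)
    chi j (X l) * ((mult i (dual (X k) \ot X l))%:R * chi j0 (X i))).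
  apply: eq_bigr => i /asboolP ai; rewrite mulrCA chi_mul_mult mulr_sumr.
  rewrite (bigID ad) /= [X in _ + X]big1 => [|l /asboolP al]; last first.
    case: (eqVneq (mult l (X k \ot X i)) 0%N) => [->|m0]; first by rewrite mul0r mulr0.
    by case: al; apply: adjoint_mult m0; apply: adjoint_tens.
  by rewrite addr0; apply: eq_bigr => l _; rewrite mult_dual; ring.
rewrite exchange_big /=; apply: eq_bigr => l /asboolP al.
rewrite -mulr_sumr mulrA -(pchi_dual (X k)) chi_mul_mult mulrC; congr (_ * _).
rewrite [RHS](bigID ad) /= [X in _ + X]big1 ?addr0// => i /asboolP ai.
case: (eqVneq (mult i (dual (X k) \ot X l)) 0%N) => [->|m0]; first by rewrite mul0r.
by case: ai; apply: adjoint_mult m0; apply: adjoint_tens => //; apply: adjoint_dual.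
Qed.

(** * Characters under the Burnside property *)

Hypothesis burn : forall i, ~ grouplike X i -> exists j, chi j (X i) = 0.

Lemma chi_eq0_sym i j : chi i (X j) = 0 -> chi j (X i) = 0.
Proof.
move=> e; have /eqP := chi_sym i j.
by rewrite e mulr0 eq_sym mulf_eq0 (negPf (chi0_neq0 _)) => /eqP.
Qed.

Lemma nonvanishing_grouplike j : (forall i, chi j (X i) != 0) -> grouplike X j.
Proof.
move=> h; case: (EM (grouplike X j)) => // /burn [i /chi_eq0_sym e].
by have := h i; rewrite e eqxx.
Qed.

Lemma pchar_grouplike : grouplike X j0.
Proof. by apply: nonvanishing_grouplike => i; rewrite gt_eqF. Qed.

(** In [chi_sym] the values at grouplikes have modulus 1, so all grouplike [a] give [chi a (X i)]
    the same modulus; [j0] is one of them. *)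
Lemma norm_chi_grouplike i j : grouplike X j -> `|chi j (X i)| = chi j0 (X i).
Proof.
have h a : grouplike X a -> `|chi a (X i)| = `|chi ord0 (X i)|.
  move=> /grouplike_chi ga; have := congr1 Num.norm (chi_sym i a).
  by rewrite !normrM !ga mulr1 mul1r.
move=> gj; rewrite h// -(h _ pchar_grouplike) ger0_norm//; exact: pchi_ge0.
Qed.

(** The objects on which the two characters agree form a fusion subcategory, and it contains each
    [S \ot dual S] by [norm_chi_grouplike]. *)
Lemma chi_adjoint j Y : grouplike X j -> in_adjoint Y -> chi j Y = chi j0 Y.
Proof.
move=> gj aY; apply: (aY (fun Z => chi j Z = chi j0 Z)); first split.
- move=> N F Z h d; rewrite [LHS](hchar_sum _ d)// [RHS](hchar_sum _ d)//.
  by apply: eq_bigr => k _; apply: h.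
- move=> N F Z h d k.
  have le l : predT l -> `|chi j (F l)| <= chi j0 (F l).
    by move=> _; apply: norm_chi_le.
  (* Equality in the triangle inequality: the terms are bounded by those of [chi j0] and the sums
     agree, so the terms agree. *)
  apply: (normC_sum_upper le) => //.
  by rewrite -[LHS](hchar_sum _ d)// -[RHS](hchar_sum _ d).
- by rewrite !chi1.
- by move=> Y1 Y2 h1 h2; rewrite !chiM h1 h2.
- by move=> Y1 h; rewrite !chi_dual h.
move=> S /reps_ex [i Si].
by rewrite !chiM !chi_dual -!normCK !(chi_iso _ Si) !norm_chi_grouplike//;
  exact: pchar_grouplike.
Qed.

(** Otherwise [regular_eigen] gives [chi j = chi j0] on the adjoint subcategory, so at every
    [X i \ot dual (X i)]; then [chi j] vanishes nowhere and [X j] is grouplike. *)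
Lemma regular_vanish j : ~ grouplike X j ->
  \sum_(i | ad i) chi j0 (X i) * chi j (X i) = 0.
Proof.
move=> ngj; apply/eqP; apply: contraT => s0; case: ngj.
apply: nonvanishing_grouplike => i.
have e k : in_adjoint (X k) -> chi j (X k) = chi j0 (X k).
  by move=> ak; apply: (mulIf s0); apply: regular_eigen.
have : chi j (X i \ot dual (X i)) = chi j0 (X i \ot dual (X i)).
  rewrite !chi_mult; apply: eq_bigr => k _.
  case: (eqVneq (mult k (X i \ot dual (X i))) 0%N) => [->|m0]; first by rewrite !mul0r.
  by rewrite e//; apply: adjoint_mult m0; apply: adjoint_tens_dual.
rewrite !chiM => h; apply/eqP => i0; move/eqP: h; rewrite i0 mul0r eq_sym.
by rewrite mulf_eq0 pchi_dual orbb gt_eqF.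
Qed.

Lemma prod_normalized_grouplike j : odd #|grouplikes| -> grouplike X j ->
  \prod_i ((chi j0 (X i))^-1 * chi j (X i)) = 1.
Proof.
move=> godd gj; set p := \prod_i _.
have [s s_inj sE] := dual_index.
have p_real : p^* = p.
  rewrite [RHS](reindex_inj s_inj) /p rmorph_prod; apply: eq_bigr => i _.
  by rewrite /= !sE rmorphM fmorphV.
have p_norm : `|p| = 1.
  rewrite normr_prod big1// => i _; rewrite normrM normfV (norm_chi_grouplike _ gj).
  by rewrite ger0_norm ?pchi_ge0// mulVf// gt_eqF.
have p2 : p ^+ 2 = 1 by rewrite expr2 -{2}p_real -normCK p_norm expr1n.
(* By the symmetry of the S-matrix, each factor is a quotient of values of
   characters at grouplike elements. *)
have pg : p ^+ #|grouplikes| = 1.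
  rewrite -prodrXl big1// => i _.
  have eS a : grouplike X a ->
      chi a (X i) = chi ord0 (X i) * chi i (X a) / chi ord0 (X a).
    by move=> ga; rewrite chi_sym mulrAC mulfV ?mul1r// grouplike_neq0.
  have e1 a : grouplike X a ->
      chi a (X i) ^+ #|grouplikes| = chi ord0 (X i) ^+ #|grouplikes|.
    by move=> ga; rewrite eS// !exprMn exprVn !(grouplike_expn _ ga) invr1 !mulr1.
  rewrite exprMn exprVn !e1// ?mulVf ?expf_neq0 ?chi0_neq0//.
  exact: pchar_grouplike.
(* Since [p ^+ 2 = 1], an odd power of [p] is [p]. *)
by rewrite -pg -[#|_|]odd_double_half godd exprD -mul2n exprM p2 expr1n mulr1.
Qed.

(** [qdim] is the character indexed by the unit, which is grouplike. *)
Lemma norm_qdim i : `|qdim (X i)| = chi j0 (X i).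
Proof.
rewrite qdim_chi norm_chi_grouplike//.
by apply/grouplike_chi => j; rewrite chi_ord0 normr1.
Qed.

Lemma adjoint_dimE : adjoint_dim X = \sum_(i | ad i) chi j0 (X i) * chi j0 (X i).
Proof.
apply: eq_bigr => i _.
by rewrite -norm_qdim !qdim_chi chi_dual -normCK expr2.
Qed.

Lemma adjoint_dim_neq0 : adjoint_dim X != 0.
Proof.
have a0 : ad ord0.
  by apply/asboolP; rewrite hX1 => P fP _; apply: fsub_unit.
rewrite adjoint_dimE (bigD1 ord0)//= gt_eqF// ltr_wpDr ?mulr_gt0//.
by rewrite sumr_ge0// => i _; rewrite mulr_ge0// pchi_ge0.
Qed.

Lemma prod_reps_regular : odd #|grouplikes| ->
  \big[Kmul X (A := K) / Kone X K]_i ((chi j0 (X i))^-1 *: Kclass X K (X i))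
  = (adjoint_dim X)^-1 *: \sum_(i | ad i) chi j0 (X i) *: Kclass X K (X i).
Proof.
move=> godd; apply: chiv_inj => j; rewrite chivZ chiv_sum.
rewrite (big_morph (chiv j) (chiv_Kmul j) (chiv_Kone j)).
under eq_bigr do rewrite chivZ chiv_Kclass.
under [in RHS]eq_bigr do rewrite chivZ chiv_Kclass.
case: (EM (grouplike X j)) => [gj|ngj].
  rewrite prod_normalized_grouplike// adjoint_dimE.
  rewrite [X in _ = _ * X](eq_bigr (fun i => chi j0 (X i) * chi j0 (X i)))
    => [|i /asboolP ai].
    by rewrite mulVf// -adjoint_dimE adjoint_dim_neq0.
  by rewrite (chi_adjoint gj).
rewrite regular_vanish// mulr0; have [i /chi_eq0_sym e] := burn ngj.
by rewrite (bigD1 i)//= e mulr0 mul0r.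
Qed.

End PositiveCharacter.

End Grothendieck.

(** * Frobenius-Perron dimensions *)

Section FrobeniusPerron.
Context {R : realType} {C : modularCat R[i]} {n : nat} (X : 'I_n.+1 -> C).
Hypotheses (hX : iso_class_reps simple X) (hX1 : X ord0 = unit_ob).
Variable j0 : 'I_n.+1.
Hypothesis chi_gt0 : forall k, 0 < chi X j0 (X k).

Lemma left_mul_mxE i j k :
  left_mul_mx X R (X i) j k = (multiplicity X k (X i \ot X j))%:R.
Proof. by rewrite mxE (Kmul_reps hX) mxE. Qed.

(** The columns of [(chimx X)^T] form a basis of right eigenvectors with eigenvalues
    [chi X l (X i)]; the left eigenvector [w] pairs nontrivially with one of them. *)
Lemma left_mul_eigenvalue i (r : R) :
  eigenvalue (left_mul_mx X R (X i)) r -> exists l, chi X l (X i) = r%:C%C.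
Proof.
move=> /eigenvalueP[w ew w0].
pose wC : 'rV[R[i]]_n.+1 := map_mx (real_complex R) w.
have wC0 : wC *m (chimx X)^T != 0.
  apply: contra w0 => /eqP e.
  have un : (chimx X)^T \in unitmx by rewrite unitmx_tr (chimx_unit hX).
  have := congr1 (mulmx^~ (invmx (chimx X)^T)) e; rewrite mulmxK// mul0mx => wC0.
  apply/eqP/rowP => k; move/rowP/(_ k): wC0.
  by rewrite !mxE => /complexI.
have [l ul] : exists l, (wC *m (chimx X)^T) 0 l != 0.
  apply/existsP; apply: contraT; rewrite negb_exists => /forallP h.
  case/eqP: wC0; apply/rowP => l; rewrite [RHS]mxE; apply/eqP.
  by have := h l; rewrite negbK.
exists l; apply: (mulIf ul).
transitivity
  ((wC *m map_mx (real_complex R) (left_mul_mx X R (X i)) *m (chimx X)^T) 0 l).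
  rewrite -mulmxA !mxE mulr_sumr; apply: eq_bigr => j _.
  rewrite !mxE mulrCA; congr (_ * _).
  rewrite (chi_mul_mult hX); apply: eq_bigr => k _.
  by rewrite [map_mx _ _ _ _]mxE left_mul_mxE rmorph_nat !mxE.
by rewrite -map_mxM ew map_mxZ -scalemxAl mxE.
Qed.

(** The values of [chi X j0] form a left eigenvector, since duality transposes the matrix and
    preserves these values. *)
Lemma eigenvalue_pchi i :
  eigenvalue (left_mul_mx X R (X i)) (complex.Re (chi X j0 (X i))).
Proof.
have dE k : (complex.Re (chi X j0 (X k)))%:C%C = chi X j0 (X k).
  by apply: RRe_real; apply: gtr0_real.
apply/eigenvalueP; exists (\row_k complex.Re (chi X j0 (X k))); last first.
  apply/eqP => /rowP/(_ ord0); rewrite !mxE => e.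
  by have := chi_gt0 ord0; rewrite -dE e ltxx.
apply/rowP => k; rewrite !mxE; apply: (@complexI R).
rewrite rmorphM /= !dE rmorph_sum /= -(pchi_dual hX hX1 chi_gt0) (chi_mul_mult hX).
apply: eq_bigr => j _; rewrite mxE left_mul_mxE rmorphM /= dE rmorph_nat.
by rewrite (mult_dual hX) mulrC.
Qed.

(** The value of [chi X j0] is an eigenvalue, and by [norm_chi_le] it bounds all the nonnegative
    ones. *)
Lemma FPdimE i : (FPdim X R (X i))%:C%C = chi X j0 (X i).
Proof.
have dE : (complex.Re (chi X j0 (X i)))%:C%C = chi X j0 (X i).
  by apply: RRe_real; apply: gtr0_real.
rewrite -dE; congr (_ %:C%C); rewrite /FPdim.
set E := [set r : R | _]%classic.
have Ed : E (complex.Re (chi X j0 (X i))).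
  by split; [rewrite -lecR dE ltW | apply: eigenvalue_pchi].
have ubE : ubound E (complex.Re (chi X j0 (X i))).
  move=> r [r0 /left_mul_eigenvalue[l e]]; rewrite -lecR dE.
  have := norm_chi_le hX hX1 chi_gt0 l (X i).
  by rewrite e ger0_norm// lecR.
apply/le_anti/andP; split.
  by apply: ge_sup => //; exists (complex.Re (chi X j0 (X i))).
by apply: ub_le_sup => //; exists (complex.Re (chi X j0 (X i))).
Qed.

End FrobeniusPerron.

(** Every ring morphism to the complex numbers is one of the [chi X j] on the simple classes. *)
Lemma burnside_chi (R : realType) (C : modularCat R[i]) n (X : 'I_n.+1 -> C) :
  iso_class_reps simple X -> X ord0 = unit_ob -> burnside X ->
  forall i, ~ grouplike X i -> exists j, chi X j (X i) = 0.
Proof.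
move=> hX hX1 hB i /hB [mu [muP mui]].
by have [j e] := ring_morphism_chi hX muP; exists j; rewrite -e.
Qed.

Local Close Scope cat_scope.

Theorem corollary1p17 (R : realType) (C : modularCat R[i])
    (m : nat) (X : 'I_m.+1 -> C)
    (hX : iso_class_reps simple X) (hX1 : X ord0 = unit_ob)
    (hB : burnside X)
    (g : nat) (G : 'I_g -> C)
    (hG : iso_class_reps invertible G) (hodd : odd g) :
  let x (i : 'I_m.+1) : 'rV[R[i]]_m.+1 := Kclass X R[i] (X i) in
  let d (i : 'I_m.+1) : R[i] := (FPdim X R (X i))%:C%C in
  \big[Kmul X (A := R[i]) / Kone X R[i]]_(i < m.+1) ((d i)^-1 *: x i)
    = (adjoint_dim X)^-1 *: \sum_(i | `[< in_adjoint (X i) >]) d i *: x i.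
Proof.
have [j0 j0P] := positive_character hX hX1.
(* The parity hypothesis on [g] passes to the simple indices of invertible objects. *)
have godd : odd #|grouplikes X| by rewrite (card_grouplikes hX hX1 j0P hG).
have := prod_reps_regular hX hX1 j0P (burnside_chi hX hX1 hB) godd.
move=> e x d; rewrite /x /d; under eq_bigr do rewrite (FPdimE hX hX1 j0P).
by under [in RHS]eq_bigr do rewrite (FPdimE hX hX1 j0P).
Qed.
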